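(* Let $n\ge 1$. The real Fourier transform $\mathscr{F}_{\mathbb{R}}:\mathscr{S}(\mathbb{R}^n,\mathbb{R})\to\mathscr{S}(\mathbb{R}^n,\mathbb{R})$ extends uniquely to a unitary map $(L^2,\|\cdot\|_2)\to(L^2,\|\cdot\|_2)$. The extension is an involution and is self-adjoint.
   Context: $\mathscr{S}(\mathbb{R}^n,\mathbb{R})$ is the real vector space of real-valued Schwartz functions on $\mathbb{R}^n$; $\cdot$ in $\mathbf{y}\cdot\mathbf{x}$ is the Euclidean inner product. The real Fourier transform is the linear operator $\mathscr{F}_{\mathbb{R}}:\mathscr{S}(\mathbb{R}^n,\mathbb{R})\to\mathscr{S}(\mathbb{R}^n,\mathbb{R})$, $$\mathscr{F}_{\mathbb{R}}[f](\mathbf{y})=\frac{1}{\sqrt{(2\pi)^n}}\int_{\mathbb{R}^n} f(\mathbf{x})\big(\cos(\mathbf{y}\cdot\mathbf{x})-\sin(\mathbf{y}\cdot\mathbf{x})\big)\,d\mathbf{x}.$$ $L^2=L^2(\mathbb{R}^n,\mathbb{R})$ is the real Hilbert space of (a.e.-equivalence classes of) square-integrable real functions, with Lebesgue measure, inner product $\langle f,g\rangle=\int_{\mathbb{R}^n} f(\mathbf{x})g(\mathbf{x})\,d\mathbf{x}$ and induced norm $\|\cdot\|_2$; $\mathscr{S}(\mathbb{R}^n,\mathbb{R})$ is regarded as a subspace of $L^2$. A unitary map is a linear bijection preserving the (real) inner product; an involution is an operator whose square is the identity. *)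

(* Defs.v *)
From HB Require Import structures.
From mathcomp Require Import all_boot all_order all_algebra.
From mathcomp Require Import all_classical all_reals all_analysis.
From mathcomp Require Import measurable_realfun ess_sup_inf.
From mathcomp Require Import ring.

Set Implicit Arguments.
Unset Strict Implicit.
Unset Printing Implicit Defensive.
Import Order.TTheory GRing.Theory Num.Theory.
Import numFieldNormedType.Exports.

Local Open Scope classical_set_scope.
Local Open Scope ring_scope.

(* The product sigma-algebra on row vectors; for real entries it is the Borel
   sigma-algebra.  As L^2 consists of classes of functions modulo almost-everywhere
   equality, completing Lebesgue measure would give the same space. *)
Definition measure_rV_display : measure_display -> measure_display.
Proof. exact. Qed.

Section measurable_rV.
Context {d : measure_display} {T : measurableType d}.
Variable n : nat.

Let coors : 'I_n -> 'rV[T]_n -> T := fun i x => x ord0 i.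

Let rV_set0 : g_sigma_preimage coors set0.
Proof. exact: sigma_algebra0. Qed.

Let rV_setC A : g_sigma_preimage coors A -> g_sigma_preimage coors (~` A).
Proof. exact: sigma_algebraC. Qed.

Let rV_bigcup (F : (set 'rV[T]_n)^nat) :
  (forall i, g_sigma_preimage coors (F i)) ->
  g_sigma_preimage coors (\bigcup_i (F i)).
Proof. exact: sigma_algebra_bigcup. Qed.

HB.instance Definition _ := @isMeasurable.Build (measure_rV_display d)
  'rV[T]_n (g_sigma_preimage coors) rV_set0 rV_setC rV_bigcup.

Lemma measurable_coord (i : 'I_n) :
  measurable_fun [set: 'rV[T]_n] (fun x : 'rV[T]_n => x ord0 i).
Proof.
move=> _ Y mY; rewrite setTI; apply: sub_sigma_algebra => /=.
rewrite -bigcup_seq/=; exists i => /=; first by rewrite mem_index_enum.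
by exists Y => //; rewrite setTI.
Qed.

Lemma measurable_fun_rVP d' (T' : measurableType d') (f : T' -> 'rV[T]_n) :
  measurable_fun [set: T'] f <->
  forall i, measurable_fun [set: T'] (fun x => f x ord0 i).
Proof.
split=> [mf i|mf].
  exact: (measurableT_comp (measurable_coord i)).
move=> _ A mA; rewrite setTI.
have: (g_sigma_preimage coors) A by [].
move: A {mA}; apply: smallest_sub.
  split => /=.
  - by rewrite preimage_set0.
  - by move=> A mA; rewrite setTD preimage_setC; exact: measurableC.
  - by move=> F mF; rewrite preimage_bigcup; exact: bigcup_measurable.
move=> A; rewrite -bigcup_seq/= => -[i _ [B mB <-]].
rewrite setTI -comp_preimage -[X in measurable X]setTI.
exact: mf.
Qed.

End measurable_rV.

Section rV_cons.
Variables (R : realType) (n : nat).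

Definition rV_cons (p : measurableTypeR R * 'rV[R]_n) : 'rV[R]_n.+1 :=
  \row_i oapp (fun j => p.2 ord0 j) p.1 (unlift ord0 i).

Definition rV_uncons (v : 'rV[R]_n.+1) : measurableTypeR R * 'rV[R]_n :=
  (v ord0 ord0, \row_i v ord0 (lift ord0 i)).

Lemma rV_consK : cancel rV_cons rV_uncons.
Proof.
case=> x v; congr (_, _); first by rewrite !mxE unlift_none.
by apply/rowP => i; rewrite !mxE liftK.
Qed.

Lemma rV_unconsK : cancel rV_uncons rV_cons.
Proof.
move=> v; apply/rowP => i; rewrite mxE.
by case: unliftP => [j|] ->//=; rewrite mxE.
Qed.

Lemma measurable_rV_cons : measurable_fun setT rV_cons.
Proof.
apply/measurable_fun_rVP => i; under eq_fun do rewrite mxE.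
case: unlift => [j|] /=; last exact: measurable_fst.
exact: (measurableT_comp (measurable_coord j) measurable_snd).
Qed.

HB.instance Definition _ :=
  @isMeasurableFun.Build _ _ _ _ rV_cons measurable_rV_cons.

Lemma measurable_rV_uncons : measurable_fun setT rV_uncons.
Proof.
apply/measurable_fun_pairP; split; first exact: measurable_coord.
apply/measurable_fun_rVP => i /=.
under eq_fun do rewrite mxE.
exact: measurable_coord.
Qed.

Variable m : {sigma_finite_measure set 'rV[R]_n -> \bar R}.

Definition lebesgue_rV_cons : set 'rV[R]_n.+1 -> \bar R :=
  pushforward (@lebesgue_measure R \x m)%E rV_cons.

Let lebesgue_rV_cons0 : lebesgue_rV_cons set0 = 0%E.
Proof. exact: measure0. Qed.

Let lebesgue_rV_cons_ge0 A : (0 <= lebesgue_rV_cons A)%E.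
Proof. exact: measure_ge0. Qed.

Let lebesgue_rV_cons_sigma_additive : semi_sigma_additive lebesgue_rV_cons.
Proof. exact: measure_semi_sigma_additive. Qed.

HB.instance Definition _ := isMeasure.Build _ _ _ lebesgue_rV_cons
  lebesgue_rV_cons0 lebesgue_rV_cons_ge0 lebesgue_rV_cons_sigma_additive.

Let lebesgue_rV_cons_sigma_finite : sigma_finite setT lebesgue_rV_cons.
Proof.
have /sigma_finiteP[F [TF ndF Foo]] := sigma_finiteT (@lebesgue_measure R).
have /sigma_finiteP[G [TG ndG Goo]] := sigma_finiteT m.
exists (fun k => rV_uncons @^-1` (F k `*` G k)).
  apply/esym; rewrite -subTset => v _.
  have [k _ Fk] : (\bigcup_k F k) (v ord0 ord0) by rewrite -TF.
  have [l _ Gl] : (\bigcup_k G k) (rV_uncons v).2 by rewrite -TG.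
  exists (maxn k l) => //; split.
  - by have /subsetPset := ndF _ _ (leq_maxl k l); exact.
  - by have /subsetPset := ndG _ _ (leq_maxr k l); exact.
move=> k; have [mF Fk] := Foo k; have [mG Gk] := Goo k; split.
  rewrite -[X in measurable X]setTI.
  by apply: measurable_rV_uncons => //; exact: measurableX.
rewrite /lebesgue_rV_cons /pushforward -comp_preimage.
rewrite (_ : _ \o _ = id) ?preimage_id.
  by rewrite product_measure1E// lte_mul_pinfty// ge0_fin_numE.
by apply/funext => x /=; rewrite rV_consK.
Qed.

HB.instance Definition _ := Measure_isSigmaFinite.Build _ _ _
  lebesgue_rV_cons lebesgue_rV_cons_sigma_finite.

End rV_cons.

Fixpoint lebesgue_rV (R : realType) (n : nat) :
    {sigma_finite_measure set 'rV[R]_n -> \bar R} :=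
  match n with
  | 0 => @dirac _ 'rV[R]_0 0 R
  | n.+1 => lebesgue_rV_cons (lebesgue_rV R n)
  end.

Lemma lebesgue_rV_box (R : realType) (n : nat) (A : 'I_n -> set R) :
  (forall i, measurable (A i)) ->
  lebesgue_rV R n [set x | forall i, A i (x ord0 i)] =
  (\prod_(i < n) lebesgue_measure (A i))%E.
Proof.
elim: n A => [|n IH] A mA.
  by rewrite big_ord0 /= diracE mem_set//= => -[].
have mB : measurable [set x : 'rV[R]_n | forall i, A (lift ord0 i) (x ord0 i)].
  rewrite (_ : mkset _ = \bigcap_(i in [set: 'I_n])
      ((fun x : 'rV[R]_n => x ord0 i) @^-1` A (lift ord0 i))); last first.
    by apply/seteqP; split=> x /= Ax i; [move=> _; exact: Ax|exact: Ax].
  apply: fin_bigcap_measurable => // i _.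
  by rewrite -[X in measurable X]setTI; exact: measurable_coord.
rewrite big_ord_recl/= /lebesgue_rV_cons /pushforward.
rewrite -(IH (fun i => A (lift ord0 i)))//.
rewrite -(@product_measure1E _ _ _ _ R (@lebesgue_measure R) (lebesgue_rV R n)
  _ _ (mA ord0) mB).
congr (_ _); apply/seteqP; split=> -[x v] /=.
  move=> Ax; split=> [|i] /=.
    by have := Ax ord0; rewrite mxE unlift_none.
  by have := Ax (lift ord0 i); rewrite mxE liftK.
move=> [/= Ax Av] i; rewrite mxE.
by case: unliftP => [j|] ->/=; [exact: Av|].
Qed.

(* Real vector space structure on the library's L^p spaces, obtained by passing
   to classes modulo almost-everywhere equality. *)
Section Lspace_lmod.
Context (d : measure_display) (T : measurableType d) (R : realType).
Variables (mu : {measure set T -> \bar R}) (p : \bar R) (p1 : (1 <= p)%E).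

HB.instance Definition _ := gen_eqMixin (LspaceType mu p1).
HB.instance Definition _ := gen_choiceMixin (LspaceType mu p1).

Lemma ae_eq_Lnorm (f g : T -> R) :
  measurable_fun setT f -> measurable_fun setT g -> f = g %[ae mu] ->
  'N[mu]_p[EFin \o f]%E = 'N[mu]_p[EFin \o g]%E.
Proof.
move=> mf mg fg; have mE (h : T -> R) : measurable_fun setT h ->
    measurable_fun setT (abse \o (EFin \o h) : T -> \bar R).
  by move=> mh; apply: measurableT_comp => //; exact/measurable_EFinP.
rewrite unlock /Lnorm; case: p => [r| |].
- congr (_ `^ _)%E; apply: ae_eq_integral => //.
  + exact: (measurableT_comp (measurable_poweR r) (mE _ mf)).
  + exact: (measurableT_comp (measurable_poweR r) (mE _ mg)).
  + by apply: filterS fg => x /= /[apply] ->.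
- case: ifP => // _; apply: eq_ess_sup.
  by apply: filterS fg => x /= /(_ I) ->.
- case: ifP => // _; apply: eq_ess_inf.
  by apply: filterS fg => x /= /(_ I) ->.
Qed.

Section Lspace_class.
Variable f : LfunType mu p1.

(* The codomain of {mfun_ mu, T >-> measurableTypeR R} is R with the same
   sigma-algebra as R but another display. *)
Let f' : T -> measurableTypeR R := f.

Let measurable_f' : measurable_fun setT f'.
Proof. exact: (@measurable_funPT _ _ T R f). Qed.

HB.instance Definition _ := @isMeasurableFun.Build _ _ _ _ f' measurable_f'.

Definition mfun_class : {mfun_ mu, T >-> measurableTypeR R} :=
  (\pi_({mfun_ mu, T >-> measurableTypeR R})%qT f').

Lemma mfun_classE : (mfun_class : T -> R) = f %[ae mu].
Proof.
have : (\pi_({mfun_ mu, T >-> measurableTypeR R}) (repr mfun_class) = mfun_class)%qT.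
  exact: reprK.
by move=> /eqquotP/asboolP.
Qed.

Lemma finite_norm_mfun_class : finite_norm mu p mfun_class.
Proof.
have mclass : @measurable_fun _ _ T R setT mfun_class.
  by move=> mT Y mY;
    exact: (@measurable_funPT _ _ T (measurableTypeR R) (repr mfun_class) mT Y).
have mf : measurable_fun setT f by exact: measurable_funPT.
by rewrite /finite_norm (ae_eq_Lnorm mclass mf mfun_classE); exact: Lfunction_finite.
Qed.

HB.instance Definition _ :=
  @isFinLebesgue.Build _ _ _ mu p p1 mfun_class finite_norm_mfun_class.

Definition Lspace_class : LspaceType mu p1 := mfun_class.

End Lspace_class.

Section Lspace_repr.
Variable u : LspaceType mu p1.

Definition Lspace_fun : T -> R := u.

Let measurable_Lspace_fun : measurable_fun setT Lspace_fun.
Proof.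
move=> mT Y mY.
exact: (@measurable_funPT _ _ T (measurableTypeR R)
  (repr (u : {mfun_ mu, T >-> measurableTypeR R})) mT Y mY).
Qed.

HB.instance Definition _ :=
  @isMeasurableFun.Build _ _ _ _ Lspace_fun measurable_Lspace_fun.
HB.instance Definition _ :=
  @isLfunction.Build _ _ _ mu p p1 Lspace_fun (@Lebesgue_finite _ _ _ _ _ _ u).

Definition Lspace_repr : LfunType mu p1 := Lspace_fun.

End Lspace_repr.

Lemma Lspace_eqP (u v : LspaceType mu p1) :
  u = v <-> Lspace_repr u = Lspace_repr v %[ae mu].
Proof.
split=> [->|]; first exact: aeW.
move=> uv.
have : (u : {mfun_ mu, T >-> measurableTypeR R}) = v.
  rewrite -[LHS]reprK -[RHS]reprK; apply/eqquotP/asboolP; exact: uv.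
case: u v {uv} => [u [[hu]]] [v [[hv]]] /= uv.
by rewrite uv in hu *; rewrite (Prop_irrelevance hu hv).
Qed.

Lemma Lspace_classK (f : LfunType mu p1) :
  Lspace_repr (Lspace_class f) = f %[ae mu].
Proof. exact: mfun_classE. Qed.

Lemma Lspace_class_eqP (f g : LfunType mu p1) :
  Lspace_class f = Lspace_class g <-> f = g %[ae mu].
Proof.
split=> [fg|fg].
  apply: (ae_eq_trans (ae_eq_sym (Lspace_classK f))); rewrite fg.
  exact: Lspace_classK.
apply/Lspace_eqP.
apply: (ae_eq_trans (Lspace_classK f)); apply: (ae_eq_trans fg).
exact: ae_eq_sym (Lspace_classK g).
Qed.

Lemma Lspace_reprK : cancel Lspace_repr Lspace_class.
Proof. by move=> u; apply/Lspace_eqP; exact: Lspace_classK. Qed.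

Let add (u v : LspaceType mu p1) :=
  Lspace_class (Lspace_repr u + Lspace_repr v).
Let opp (u : LspaceType mu p1) := Lspace_class (- Lspace_repr u).
Let zero : LspaceType mu p1 := Lspace_class 0.
Let scale (a : R) (u : LspaceType mu p1) := Lspace_class (a *: Lspace_repr u).

Let add_class f g :
  add (Lspace_class f) (Lspace_class g) = Lspace_class (f + g).
Proof.
apply/Lspace_class_eqP.
apply: filterS2 (Lspace_classK f) (Lspace_classK g) => x /(_ I) fx /(_ I) gx _.
exact: (congr2 +%R fx gx).
Qed.

Let opp_class f : opp (Lspace_class f) = Lspace_class (- f).
Proof.
apply/Lspace_class_eqP; apply: filterS (Lspace_classK f) => x /(_ I) fx _.
exact: (congr1 -%R fx).
Qed.

Let scale_class a f : scale a (Lspace_class f) = Lspace_class (a *: f).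
Proof.
apply/Lspace_class_eqP; apply: filterS (Lspace_classK f) => x /(_ I) fx _.
exact: (congr1 ( *%R a) fx).
Qed.

Let addA : associative add.
Proof.
move=> u v w; rewrite -(Lspace_reprK u) -(Lspace_reprK v) -(Lspace_reprK w).
by rewrite !add_class addrA.
Qed.

Let addC : commutative add.
Proof. by move=> u v; rewrite /add addrC. Qed.

Let add0 : left_id zero add.
Proof. by move=> u; rewrite -(Lspace_reprK u) add_class add0r. Qed.

Let addN : left_inverse zero opp add.
Proof. by move=> u; rewrite -(Lspace_reprK u) opp_class add_class addNr. Qed.

HB.instance Definition _ :=
  GRing.isZmodule.Build (LspaceType mu p1) addA addC add0 addN.

Let classD (f g : LfunType mu p1) :
  Lspace_class f + Lspace_class g = Lspace_class (f + g).
Proof. exact: add_class. Qed.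

Let scaleA a b u : scale a (scale b u) = scale (a * b) u.
Proof. by rewrite -(Lspace_reprK u) !scale_class scalerA. Qed.

Let scale1 : left_id 1 scale.
Proof. by move=> u; rewrite -(Lspace_reprK u) scale_class scale1r. Qed.

Let scaleDr : right_distributive scale +%R.
Proof.
move=> a u v; rewrite -(Lspace_reprK u) -(Lspace_reprK v).
by rewrite classD !scale_class classD scalerDr.
Qed.

Let scaleDl u : {morph scale^~ u : a b / a + b}.
Proof.
move=> a b; rewrite -(Lspace_reprK u) !scale_class classD.
by rewrite scalerDl.
Qed.

HB.instance Definition _ := GRing.Zmodule_isLmodule.Build R (LspaceType mu p1)
  scaleA scale1 scaleDr scaleDl.

Lemma Lspace_class_is_linear : linear Lspace_class.
Proof. move=> a f g; rewrite -classD; congr (_ + _).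
exact: esym (scale_class a f). Qed.

HB.instance Definition _ := GRing.isLinear.Build R (LfunType mu p1)
  (LspaceType mu p1) _ Lspace_class Lspace_class_is_linear.

End Lspace_lmod.

Section Lspace2_dot.
Context (d : measure_display) (T : measurableType d) (R : realType).
Variables (mu : {measure set T -> \bar R}).

Definition Lspace2_dot (u v : LspaceType2 mu) : R :=
  \int[mu]_x (Lspace_repr u x * Lspace_repr v x).

End Lspace2_dot.

Section schwartz.
Variables (R : realType) (n : nat).
Implicit Types (f : 'rV[R]_n -> R) (x y : 'rV[R]_n).

Definition partial (i : 'I_n) f : 'rV[R]_n -> R :=
  fun x => 'D_(delta_mx ord0 i) f x.

(* The derivative of multi-index b is obtained from any s containing each i
   exactly b i times. *)
Definition partials (s : seq 'I_n) f : 'rV[R]_n -> R := foldr partial f s.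

Definition smooth f := forall s : seq 'I_n,
  continuous (partials s f) /\
  forall i x, derivable (partials s f) x (delta_mx ord0 i).

Definition monomial (a : 'I_n -> nat) x : R := \prod_(i < n) x ord0 i ^+ a i.

Definition schwartz f := smooth f /\
  forall (a : 'I_n -> nat) (s : seq 'I_n), exists M : R, forall x,
    `|monomial a x * partials s f x| <= M.

Definition rV_dot x y : R := \sum_(i < n) x ord0 i * y ord0 i.

Definition real_fourier f : 'rV[R]_n -> R := fun y =>
  (Num.sqrt ((2 * pi) ^+ n))^-1 *
  \int[lebesgue_rV R n]_x (f x * (cos (rV_dot y x) - sin (rV_dot y x))).

End schwartz.

Section schwartz_Lfun.
Variable R : realType.

Lemma open_measurable_rV n (U : set 'rV[R]_n) : open U -> measurable U.
Proof.
move=> oU.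
pose box (q : 'rV[rat]_n * nat) : set 'rV[R]_n :=
  [set x | forall i, `|x ord0 i - ratr (q.1 ord0 i)| < q.2.+1%:R^-1].
have mbox q : measurable (box q).
  rewrite (_ : box q = \bigcap_(i in [set: 'I_n]) ((fun x : 'rV[R]_n => x ord0 i)
      @^-1` [set r | `|r - ratr (q.1 ord0 i)| < q.2.+1%:R^-1])); last first.
    by apply/seteqP; split=> x /= Ax i; [move=> _; exact: Ax|exact: Ax].
  apply: fin_bigcap_measurable => // i _.
  rewrite -[X in measurable X]setTI; apply: measurable_coord => //.
  apply: open_measurable.
  rewrite (_ : mkset _ = ball (ratr (q.1 ord0 i) : R) q.2.+1%:R^-1).
    exact: ball_open.
  by apply/seteqP; split=> r /=; rewrite -ball_normE /= distrC.
rewrite (_ : U = \bigcup_q (if `[< box q `<=` U >] then box q else set0)).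
  apply: countable_bigcupT_measurable => [|q]; first exact: countableP.
  by case: ifP.
apply/seteqP; split=> [x Ux|x [q _]]; last by case: asboolP => [bU /bU|_ []].
have : nbhs x U by exact: open_nbhs_nbhs.
move=> /nbhs_ballP[e /= e0 xeU].
have [k ke] : exists k : nat, k.+1%:R^-1 < e / 2.
  exists (Num.truncn (e / 2)^-1).
  rewrite invf_plt ?posrE ?divr_gt0//.
  by rewrite truncnS_gt.
have k0 : 0 < k.+1%:R^-1 :> R by rewrite invr_gt0.
have qex i : {q : rat | `|x ord0 i - ratr q| < k.+1%:R^-1}.
  apply: cid.
  have /rat_in_itvoo[q] : x ord0 i - k.+1%:R^-1 < x ord0 i by rewrite ltrBlDr ltrDl.
  rewrite in_itv/= => /andP[h1 h2]; exists q.
  by rewrite gtr0_norm ?subr_gt0// ltrBlDr -ltrBlDl.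
pose q := \row_i sval (qex i).
exists (q, k) => //.
have bqx : box (q, k) x.
  by move=> i; rewrite /= mxE; exact: (svalP (qex i)).
case: asboolP => // -[]; move=> z bqz; apply: xeU; split=> // i j.
rewrite !(ord1 i) -ball_normE/=.
rewrite (le_lt_trans (ler_distD (ratr (q ord0 j)) _ _))//.
rewrite (splitr e) ltrD//.
  by rewrite (lt_trans (bqx j)).
by rewrite distrC (lt_trans (bqz j)).
Qed.

Lemma continuous_measurable_rV n (f : 'rV[R]_n -> R) :
  continuous f -> measurable_fun setT f.
Proof.
move=> /continuousP cf; apply: (measurability _ (RGenOpens.measurableE R)) => //.
move=> _ [_ [a [b ->]] <-]; rewrite setTI.
by apply: open_measurable_rV; apply: cf; exact: interval_open.
Qed.

Lemma integral_oneDsqrV :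
  (\int[@lebesgue_measure R]_x ((oneDsqr x)^-1)%:E = pi%:E)%E.
Proof.
have ge0 (x : R) : 0 <= (oneDsqr x)^-1 by rewrite invr_ge0 ltW// oneDsqr_gt0.
have even : (fun x : R => (oneDsqr x)^-1) =1 (fun x => (oneDsqr x)^-1) \o -%R.
  by move=> x /=; rewrite /oneDsqr sqrrN.
rewrite (ge0_symfun_integralT ge0 (@continuous_oneDsqrV R) even).
rewrite -set_itvcy (@ge0_continuous_FTC2y _ _ atan 0 (pi / 2)).
- by rewrite atan0 sube0 -EFinM mulrCA mulfV ?mulr1.
- by [].
- apply: continuous_subspaceT; exact: continuous_oneDsqrV.
- exact: cvgy_atan.
- by move=> x _; exact: derivable_atan.
- by apply: cvg_at_right_filter; exact: continuous_atan.
- by move=> x _; rewrite derive1_atan.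
Qed.

Lemma integral_prod_oneDsqrV n :
  (\int[lebesgue_rV R n]_x (\prod_(i < n) (oneDsqr (x ord0 i))^-1)%:E
   = (pi ^+ n)%:E)%E.
Proof.
have mg m : measurable_fun setT
    (fun x : 'rV[R]_m => (\prod_(i < m) (oneDsqr (x ord0 i))^-1)%:E).
  apply/measurable_EFinP; apply: measurable_prod => i _.
  apply: (@measurableT_comp _ _ _ _ _ _ (fun t : R => (oneDsqr t)^-1)).
    by apply: continuous_measurable_fun; exact: continuous_oneDsqrV.
  exact: measurable_coord.
elim: n => [|n IH].
  under eq_integral do rewrite big_ord0.
  by rewrite integral_cst//= diracT mule1.
have g0 m (x : 'rV[R]_m) : (0 <= (\prod_(i < m) (oneDsqr (x ord0 i))^-1)%:E)%E.
  by rewrite lee_fin prodr_ge0// => i _; rewrite invr_ge0 ltW// oneDsqr_gt0.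
have g0' : {in [set: 'rV[R]_n.+1], forall x : 'rV[R]_n.+1,
    (0 <= (\prod_(i < n.+1) (oneDsqr (x ord0 i))^-1)%:E)%E} by move=> x _; exact: g0.
rewrite /= [LHS](ge0_integral_pushforward (@measurable_rV_cons R n) _
  measurableT (mg n.+1) g0')/=.
rewrite preimage_setT.
transitivity (\int[@lebesgue_measure R \x lebesgue_rV R n]_z
  ((oneDsqr z.1)^-1%:E * (\prod_(i < n) (oneDsqr (z.2 ord0 i))^-1)%:E))%E.
  apply: eq_integral => -[x y] _ /=; rewrite -EFinM big_ord_recl/= !mxE unlift_none/=.
  by congr (_ * _)%:E; apply: eq_bigr => i _; rewrite mxE liftK.
have o0 (t : R) : (0 <= ((oneDsqr t)^-1)%:E)%E.
  by rewrite lee_fin invr_ge0 ltW// oneDsqr_gt0.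
have mo : measurable_fun [set: measurableTypeR R] (fun t => ((oneDsqr t)^-1)%:E).
  apply/measurable_EFinP; apply: continuous_measurable_fun.
  exact: continuous_oneDsqrV.
rewrite fubini_tonelli1/=; last 2 first.
- by apply: emeasurable_funM; [exact: measurableT_comp mo _
    |exact: measurableT_comp (mg n) _].
- by move=> z; exact: mule_ge0 (o0 _) (g0 _ _).
rewrite /fubini_F/=.
transitivity (\int[@lebesgue_measure R]_x (((oneDsqr x)^-1)%:E * (pi ^+ n)%:E))%E.
  apply: eq_integral => x _; rewrite -IH -(ge0_integralZl _ measurableT (mg n))//.
by rewrite ge0_integralZr//= ?integral_oneDsqrV ?exprS// lee_fin exprn_ge0// pi_ge0.
Qed.

Lemma schwartz_prod_bound n (f : 'rV[R]_n -> R) : schwartz f ->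
  exists M : R, forall x, `|f x| <= M * \prod_(i < n) (oneDsqr (x ord0 i))^-1.
Proof.
move=> [_ fb].
have bnd (r : seq 'I_n) (a : 'I_n -> nat) : exists M : R, forall x,
    `|monomial a x * (\prod_(i <- r) oneDsqr (x ord0 i)) * f x| <= M.
  elim: r a => [|i r IH] a.
    have [M fM] := fb a [::]; exists M => x.
    by rewrite big_nil mulr1; exact: fM.
  have [M1 fM1] := IH a.
  have [M2 fM2] := IH (fun j => a j + 2 * (j == i))%N.
  exists (M1 + M2) => x; rewrite big_cons.
  have -> : monomial a x * (oneDsqr (x ord0 i) * \prod_(j <- r) oneDsqr (x ord0 j))
      * f x = monomial a x * (\prod_(j <- r) oneDsqr (x ord0 j)) * f x +
      monomial (fun j => a j + 2 * (j == i))%N x *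
      (\prod_(j <- r) oneDsqr (x ord0 j)) * f x.
    have -> : monomial (fun j => a j + 2 * (j == i))%N x =
        monomial a x * x ord0 i ^+ 2.
      rewrite /monomial; under eq_bigr do rewrite exprD.
      rewrite big_split/=; congr (_ * _).
      rewrite (bigD1 i)//= eqxx muln1 big1 ?mulr1// => j /negbTE ->.
      by rewrite muln0 expr0.
    by rewrite /oneDsqr; ring.
  by rewrite (le_trans (ler_normD _ _))// lerD.
have [M fM] := bnd (index_enum 'I_n) (fun=> 0%N); exists M => x.
have := fM x; rewrite /monomial big1 ?mul1r; last by move=> i _; rewrite expr0.
have P0 : 0 < \prod_(i < n) oneDsqr (x ord0 i).
  by rewrite prodr_gt0// => i _; rewrite oneDsqr_gt0.
by rewrite prodfV ler_pdivlMr// normrM mulrC (gtr0_norm P0).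
Qed.

Lemma schwartz_Lfun2 n (f : 'rV[R]_n -> R) : schwartz f ->
  f \in Lfun (lebesgue_rV R n) 2%:R%:E.
Proof.
move=> sf.
have mf : measurable_fun setT f.
  by apply: continuous_measurable_rV; have [/(_ [::])[]] := sf.
rewrite inE; apply/andP; split; rewrite inE//=.
rewrite /finite_norm unlock /Lnorm poweR_lty//.
have [M fM] := schwartz_prod_bound sf.
pose g (x : 'rV[R]_n) := \prod_(i < n) (oneDsqr (x ord0 i))^-1.
have g0 x : 0 <= g x.
  by rewrite prodr_ge0// => i _; rewrite invr_ge0 ltW// oneDsqr_gt0.
have g1 x : g x <= 1.
  by rewrite prodr_ile1// => i _; rewrite invr_ge0 ltW ?oneDsqr_gt0//= oneDsqrV_le1.
have mg : measurable_fun setT (EFin \o g).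
  apply/measurable_EFinP; apply: measurable_prod => i _.
  apply: (@measurableT_comp _ _ _ _ _ _ (fun t : R => (oneDsqr t)^-1)).
    by apply: continuous_measurable_fun; exact: continuous_oneDsqrV.
  exact: measurable_coord.
apply: (@le_lt_trans _ _ (\int[lebesgue_rV R n]_x ((M ^+ 2)%:E * (g x)%:E)))%E.
  apply: ge0_le_integral => //.
  - by move=> x _; exact: poweR_ge0.
  - apply: (measurableT_comp (measurable_poweR _)).
    by apply: measurableT_comp => //; exact/measurable_EFinP.
  - exact: measurable_funeM.
  - move=> x _; rewrite -EFinM /= lee_fin powR_mulrn//.
    rewrite (le_trans (lerXn2r _ _ _ (fM x)))// ?nnegrE//.
      exact: le_trans (normr_ge0 _) (fM x).
    rewrite -/(g x) exprMn ler_wpM2l ?sqr_ge0//.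
    by rewrite expr2 ler_piMl.
rewrite ge0_integralZl//= ?lee_fin ?sqr_ge0//.
  by rewrite integral_prod_oneDsqrV -EFinM ltry.
by move=> x _; rewrite lee_fin.
Qed.

End schwartz_Lfun.

Section L2.
Variables (R : realType) (n : nat).

Definition L2 := LspaceType2 (lebesgue_rV R n).

Definition schwartz_L2 (f : 'rV[R]_n -> R) (sf : schwartz f) : L2 :=
  Lspace_class (Lfun_Sub (lee1n 2) (schwartz_Lfun2 sf)).

Definition unitary (T : L2 -> L2) :=
  [/\ linear T, bijective T &
      forall u v, Lspace2_dot (T u) (T v) = Lspace2_dot u v].

Definition self_adjoint (T : L2 -> L2) :=
  forall u v, Lspace2_dot (T u) v = Lspace2_dot u (T v).

(* The almost-everywhere equality says that real_fourier f belongs to the class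
   T f; in particular that it is square-integrable. *)
Definition extends_real_fourier (T : L2 -> L2) :=
  forall (f : 'rV[R]_n -> R) (sf : schwartz f),
    Lspace_repr (T (schwartz_L2 sf)) = real_fourier f %[ae lebesgue_rV R n].

End L2.

(* Main.v *)
(* Write H for the transform on integrable functions; by Fubini it is symmetric for the L^2
   pairing.  Damping by a Gaussian turns |H f|^2 into the pairing of f with its Gaussian
   mean, and f(x) f(z) <= (f(x)^2 + f(z)^2) / 2 then bounds it by |f|^2 without any
   approximation argument; Fatou's lemma gives |H f| <= |f| on L^1 /\ L^2.  Completeness of
   L^2 extends H, via truncations, to a symmetric contraction T.

   H exchanges the Gaussian g_c centred at c with the wave
   exp(-|y|^2/2) (cos(y.c) - sin(y.c)), and the waves are total in L^2: if w is orthogonal to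
   all of them, then H annihilates the integrable function w exp(-|y|^2/2), which therefore
   has null Gaussian means, hence null integrals over all orthants, and vanishes almost
   everywhere.  Symmetry now gives <T T u, wave> = <u, wave>, so T is an involution, and a
   symmetric involution is unitary.  A unitary S extending H sends the Schwartz function g_c
   to the wave at c, so <S u, wave> = <u, g_c> = <T u, wave>, whence S = T. *)
Require Import Defs.
From mathcomp Require Import all_boot all_order all_algebra.
From mathcomp Require Import all_classical all_reals all_analysis.
From mathcomp Require Import measurable_realfun.
From mathcomp Require Import ring lra.

Set Implicit Arguments.
Unset Strict Implicit.
Unset Printing Implicit Defensive.
Import Order.TTheory GRing.Theory Num.Theory.
Import numFieldNormedType.Exports.

Local Open Scope classical_set_scope.
Local Open Scope ring_scope.

(** The transform is its own inverse because the kernel [cas = cos - sin] satisfies [cas a * cas b =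
    cos (a - b) - sin (a + b)]. Against an even Gaussian the sine part integrates to 0 and the
    cosine part depends on the difference alone. So transforming [H f] times a Gaussian returns a
    Gaussian mean of [f], although this kernel, unlike the complex one, does not turn translations
    into phases.

    The wave at [c] is the kernel at [c] times a fixed Gaussian. Pairing [w] with all waves thus
    computes the transform of [w] times that Gaussian, which is integrable as a product of two L^2
    functions: this is how a totality statement in L^2 becomes an injectivity statement in L^1. With
    the exponent [-|x|^2/2] and the factor [(2 pi)^(-n/2)], Gaussians and waves are exchanged with
    no constant left over.

    The real integral is [fine] of the extended one, hence 0 by default on functions whose integral
    is infinite. The formula for [H] therefore carries information on L^1 only, and every general
    L^2 function enters through its truncations to boxes. *)

Notation integ mu f := ((mu).-integrable setT (EFin \o f)).

(** * Real-valued integrals *)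

Section real_integrals.
Context d (T : measurableType d) (R : realType).
Variable mu : {measure set T -> \bar R}.
Implicit Types f g : T -> R.

Lemma integ_measurable f : integ mu f -> measurable_fun setT f.
Proof. by move=> /integrableP[/measurable_EFinP]. Qed.

Lemma integ_le f g : measurable_fun setT f -> (forall x, `|f x| <= g x) ->
  integ mu g -> integ mu f.
Proof.
move=> mf fg; apply: le_integrable => //; first exact/measurable_EFinP.
by move=> x _ /=; rewrite lee_fin (le_trans (fg x))// ler_norm.
Qed.

Lemma integZl f k : integ mu f -> integ mu (fun x => k * f x).
Proof.
by move=> i; rewrite (_ : _ \o _ = fun x => (k%:E * (EFin \o f) x)%E) //; exact: integrableZl.
Qed.

Lemma integD f g : integ mu f -> integ mu g -> integ mu (fun x => f x + g x).
Proof.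
move=> fi gi; rewrite (_ : _ \o _ = ((EFin \o f) \+ (EFin \o g))%E) //.
exact: integrableD.
Qed.

Lemma integB f g : integ mu f -> integ mu g -> integ mu (fun x => f x - g x).
Proof.
move=> fi gi; rewrite (_ : _ \o _ = ((EFin \o f) \- (EFin \o g))%E) //.
exact: integrableB.
Qed.

Lemma integMb f g (M : R) : integ mu f -> measurable_fun setT g ->
  (forall x, `|g x| <= M) -> integ mu (fun x => f x * g x).
Proof.
move=> fi mg gM; apply: (@integ_le _ (fun x => M * `|f x|)).
- by apply: measurable_funM => //; exact: integ_measurable.
- by move=> x; rewrite normrM mulrC ler_wpM2r.
- by apply: integZl; exact: integrable_norm.
Qed.

Lemma EFin_Rintegral f : integ mu f ->
  (\int[mu]_x f x)%:E = (\int[mu]_x (f x)%:E)%E.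
Proof. by move=> fi; rewrite fineK// integrable_fin_num. Qed.

Lemma Rdominated_cvg (f_ : nat -> T -> R) f g :
  (forall n, measurable_fun setT (f_ n)) -> measurable_fun setT f ->
  {ae mu, forall x, f_ n x @[n --> \oo] --> f x} ->
  integ mu g -> (forall n x, `|f_ n x| <= g x) ->
  \int[mu]_x f_ n x @[n --> \oo] --> \int[mu]_x f x.
Proof.
move=> mf_ mf ff ig fg.
have [] := @dominated_convergence _ T R mu setT measurableT
  (fun n => EFin \o f_ n) (EFin \o f) (EFin \o g).
- by move=> n; exact/measurable_EFinP.
- exact/measurable_EFinP.
- by apply: filterS ff => x /= fx _; apply/fine_cvgP; split => //; exact: nearW.
- exact: ig.
- by apply: aeW => x n _ /=; rewrite lee_fin.
move=> fi _ H.
by apply: fine_cvg; rewrite EFin_Rintegral.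
Qed.

End real_integrals.

(** * The Fourier integral of a Gaussian on the line *)

Section gauss1.
Variable R : realType.
Local Notation leb := (@lebesgue_measure R).

(** Fundamental theorem of calculus on [[-(k + 1), k + 1]]: the decay hypothesis bounds each
    boundary term by [M / (k + 1)], and dominated convergence with majorant [|f|] passes to the
    line. This serves as integration by parts for the Gaussian integrals below. *)
Lemma integral_derive_eq0 (F f : R -> R) (M : R) :
  (forall x : R, is_derive x 1 F (f x)) -> continuous f -> integ leb f ->
  (forall x, `|x| * `|F x| <= M) ->
  \int[leb]_x f x = 0.
Proof.
move=> dF cf fi FM.
have F0 (u : nat -> R) : (forall k, `|u k| = k.+1%:R) ->
    F (u k) @[k --> \oo] --> (0 : R).
  move=> uk; apply: norm_cvg0.
  have h : M * harmonic k @[k --> \oo] --> (0 : R).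
    by rewrite -(mulr0 M); apply: cvgMr; exact: cvg_harmonic.
  apply: (squeeze_cvgr _ (@cvg_cst _ (0 : R) _ _ _) h); near=> k.
  rewrite normr_ge0/= ler_pdivlMr// mulrC -(uk k); exact: FM.
have mf := integ_measurable fi.
pose f_ (k : nat) := f \_ `[- k.+1%:R, k.+1%:R].
have mf_ k : measurable_fun setT (f_ k).
  by apply/(measurable_restrictT _ _).1 => //; exact: measurable_funTS.
have int_f_ k : \int[leb]_x f_ k x = F k.+1%:R - F (- k.+1%:R).
  rewrite -Rintegral_mkcond.
  have cF : continuous F.
    move=> x; apply: differentiable_continuous; apply/derivable1_diffP.
    by have [] := dF x.
  rewrite /Rintegral (@continuous_FTC2 _ f F)//.
  - by rewrite (@lt_trans _ _ 0)// oppr_lt0.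
  - exact: continuous_subspaceT.
  - split.
    + by move=> x _; have [] := dF x.
    + by apply: cvg_at_right_filter; exact: cF.
    + by apply: cvg_at_left_filter; exact: cF.
  - by move=> x _; rewrite derive1E; have [] := dF x.
have h1 : \int[leb]_x f_ n x @[n --> \oo] --> \int[leb]_x f x.
  apply: (@Rdominated_cvg _ _ R leb f_ f (Num.norm \o f) mf_ mf).
  - apply: aeW => x; apply: (cvg_near_cst (f x)).
    near=> k; rewrite /f_ patchE mem_set//= in_itv/= -ler_norml.
    rewrite (@le_trans _ _ k%:R) ?ler_nat//.
    near: k; exact: nbhs_infty_ger.
  - exact: integrable_norm.
  - by move=> k x; rewrite /f_ patchE; case: ifP => //= _; rewrite normr0.
have h2 : \int[leb]_x f_ n x @[n --> \oo] --> 0 - (0 : R).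
  under eq_fun do rewrite int_f_.
  by apply: cvgB; apply: F0 => k; rewrite ?normrN ger0_norm.
by rewrite -(cvg_lim _ h1)// (cvg_lim _ h2)// subrr.
Unshelve. all: by end_near. Qed.

Variable e : R.
Hypothesis e0 : 0 < e.

(** Here [e] is the precision: this is an unnormalised normal density of variance [e^-1], and its
    Fourier integral is a multiple of [gauss e^-1]. *)
Definition gauss (t : R) := expR (- (e * t ^+ 2 / 2)).

Lemma gauss_gt0 t : 0 < gauss t. Proof. exact: expR_gt0. Qed.

Lemma gauss_le1 t : gauss t <= 1.
Proof. by rewrite /gauss expR_le1 oppr_le0 divr_ge0// mulr_ge0 ?sqr_ge0// ltW. Qed.

Lemma gaussN t : gauss (- t) = gauss t.
Proof. by rewrite /gauss sqrrN. Qed.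

Lemma is_derive_gauss c (t : R) :
  is_derive t 1 (fun t => gauss (t - c)) (- (e * (t - c)) * gauss (t - c)).
Proof.
rewrite /gauss; apply: is_derive_eq.
by rewrite /GRing.scale/=; field.
Qed.

End gauss1.

Section gauss1_integral.
Variable R : realType.
Local Notation leb := (@lebesgue_measure R).
Variable e : R.
Hypothesis e0 : 0 < e.

Lemma continuous_gauss c : continuous (fun t => gauss e (t - c)).
Proof.
move=> t; apply: differentiable_continuous; apply/derivable1_diffP.
by have [] := is_derive_gauss e c t.
Qed.

Lemma normal_pdf_gauss c t : normal_pdf c (Num.sqrt e^-1) t =
  (Num.sqrt (2 * pi / e))^-1 * gauss e (t - c).
Proof.
rewrite normal_pdfE; last by rewrite gt_eqF// sqrtr_gt0 invr_gt0.
rewrite /normal_peak /normal_fun /gauss sqr_sqrtr ?invr_ge0 ?ltW//.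
congr (_ * expR _).
  by congr (Num.sqrt _)^-1; rewrite -mulr_natl; ring.
by field; rewrite gt_eqF.
Qed.

Lemma integ_gauss c : integ leb (fun t => gauss e (t - c)).
Proof.
have h := @integrable_normal_pdf R c (Num.sqrt e^-1).
have := integZl (Num.sqrt (2 * pi / e)) h.
congr (integrable _ _ _); apply/funext => t /=; rewrite normal_pdf_gauss.
rewrite mulrA mulfV ?mul1r// gt_eqF// sqrtr_gt0 divr_gt0// mulr_gt0//.
exact: pi_gt0.
Qed.

Lemma integral_gauss c : \int[leb]_t gauss e (t - c) = Num.sqrt (2 * pi / e).
Proof.
have s0 : Num.sqrt (2 * pi / e) != 0.
  by rewrite gt_eqF// sqrtr_gt0 divr_gt0// mulr_gt0// pi_gt0.
have : \int[leb]_t (normal_pdf c (Num.sqrt e^-1) t) = 1.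
  by rewrite /Rintegral integral_normal_pdf.
under eq_Rintegral do rewrite normal_pdf_gauss.
rewrite RintegralZl//; last exact: integ_gauss.
by move=> h; apply: (mulfI (invr_neq0 s0)); rewrite h mulVf.
Qed.

End gauss1_integral.

Section gauss1_fourier.
Variable R : realType.
Local Notation leb := (@lebesgue_measure R).
Variable e : R.
Hypothesis e0 : 0 < e.
Variable c : R.

Let G t := gauss e (t - c).

Let mG : measurable_fun setT G.
Proof. by apply: continuous_measurable_fun; exact: continuous_gauss. Qed.

(** Half of the exponent pays for the factor [|t|]: with [s = e t^2 / 4], [(1 + s) exp(-s) <= 1] and
    [|t| <= (1 + e^-1) (1 + s)]. The other half remains as an integrable majorant that does not
    depend on the frequency. *)
Lemma gauss_moment_le t : `|t| * gauss e t <= (1 + e^-1) * gauss (e / 2) t.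
Proof.
have -> : gauss e t = gauss (e / 2) t * gauss (e / 2) t.
  by rewrite /gauss -expRD; congr expR; field.
rewrite mulrA ler_wpM2r ?expR_ge0// -[leRHS]mulr1.
have h : (1 + e * t ^+ 2 / 4) * gauss (e / 2) t <= 1.
  rewrite /gauss expRN ler_pdivrMr ?expR_gt0// mul1r.
  by apply: le_trans (expR_ge1Dx _); rewrite lerD2l le_eqVlt; apply/orP; left; apply/eqP; field.
apply: (@le_trans _ _ ((1 + e^-1) * ((1 + e * t ^+ 2 / 4) * gauss (e / 2) t))).
  rewrite mulrA ler_wpM2r ?expR_ge0//.
  have -> : (1 + e^-1) * (1 + e * t ^+ 2 / 4) =
     1 + t ^+ 2 / 4 + (e^-1 + e * t ^+ 2 / 4) by field; rewrite gt_eqF.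
  have : 0 <= e^-1 + e * t ^+ 2 / 4.
    have e0' := ltW e0.
    by rewrite addr_ge0 ?invr_ge0// divr_ge0// mulr_ge0// sqr_ge0.
  (* This square gives [|t| <= 1 + t^2 / 4]. *)
  have := sqr_ge0 (`|t| / 2 - 1); rewrite -(real_normK (num_real t)).
  nra.
by rewrite ler_wpM2l// addr_ge0// invr_ge0 ltW.
Qed.

Let integ_moment : integ leb (fun t => (1 + e^-1) * gauss (e / 2) (t - c)).
Proof. by apply: integZl; apply: integ_gauss; rewrite divr_gt0. Qed.

(* With the phase centred at c, A and B both solve F' = - (y / e) F, and no translation of
   the integral is needed. *)
Let A y := \int[leb]_t (G t * cos (y * (t - c))).
Let B y := \int[leb]_t (G t * sin (y * (t - c))).

Let mlin y : measurable_fun setT (fun t : R => y * (t - c)).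
Proof. by apply: measurable_funM => //; exact: measurable_funB. Qed.

Let mcosl y : measurable_fun setT (fun t : R => cos (y * (t - c))).
Proof.
apply: measurableT_comp (mlin y); apply: continuous_measurable_fun.
exact: continuous_cos.
Qed.

Let msinl y : measurable_fun setT (fun t : R => sin (y * (t - c))).
Proof.
apply: measurableT_comp (mlin y); apply: continuous_measurable_fun.
exact: continuous_sin.
Qed.

Let mmG : measurable_fun setT (fun t : R => (t - c) * G t).
Proof. by apply: measurable_funM => //; exact: measurable_funB. Qed.

Let integGcos (y : R) : integ leb (fun t => G t * cos (y * (t - c))).
Proof. by apply: (integMb (M := 1)) => [||x]; [exact: integ_gauss|exact: mcosl|exact: cos_max]. Qed.

Let integGsin (y : R) : integ leb (fun t => G t * sin (y * (t - c))).
Proof. by apply: (integMb (M := 1)) => [||x]; [exact: integ_gauss|exact: msinl|exact: sin_max]. Qed.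

Let integ_mGsin (y : R) : integ leb (fun t => (t - c) * G t * sin (y * (t - c))).
Proof.
apply: (integ_le _ _ integ_moment).
  by apply: measurable_funM; [exact: mmG|exact: msinl].
move=> t; rewrite !normrM [X in _ * X * _]ger0_norm ?expR_ge0//.
apply: le_trans (gauss_moment_le (t - c)).
by rewrite -[leRHS]mulr1 ler_wpM2l ?sin_max// mulr_ge0// expR_ge0.
Qed.

Let integ_mGcos (y : R) : integ leb (fun t => (t - c) * G t * cos (y * (t - c))).
Proof.
apply: (integ_le _ _ integ_moment).
  by apply: measurable_funM; [exact: mmG|exact: mcosl].
move=> t; rewrite !normrM [X in _ * X * _]ger0_norm ?expR_ge0//.
apply: le_trans (gauss_moment_le (t - c)).
by rewrite -[leRHS]mulr1 ler_wpM2l ?cos_max// mulr_ge0// expR_ge0.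
Qed.

(** The decay that [integral_derive_eq0] asks for; [h] stands for the value of the sine or
    cosine. *)
Let gauss_moment_bound (h : R) t : `|h| <= 1 ->
  `|t| * `|G t * h| <= 1 + e^-1 + `|c|.
Proof.
move=> h1; rewrite normrM [`|G t|]ger0_norm ?expR_ge0//.
have tc : `|t| <= `|t - c| + `|c| by rewrite -{1}(subrK c t) ler_normD.
have m := gauss_moment_le (t - c).
have g1 : gauss (e / 2) (t - c) <= 1 by apply: gauss_le1; rewrite divr_gt0.
have G1 : G t <= 1 by exact: gauss_le1.
have G0 : 0 <= G t by exact: expR_ge0.
apply: (@le_trans _ _ (`|t| * G t)); first by rewrite mulrA -[leRHS]mulr1 ler_wpM2l// mulr_ge0.
apply: (@le_trans _ _ ((`|t - c| + `|c|) * G t)); first by rewrite ler_wpM2r.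
rewrite mulrDl lerD//; last by rewrite -[leRHS]mulr1 ler_wpM2l.
by apply: le_trans m _; rewrite -[leRHS]mulr1 ler_wpM2l// addr_ge0// invr_ge0 ltW.
Qed.

Let is_derive_cosy (t y : R) : is_derive y (1 : R) (fun y => G t * cos (y * (t - c)))
  (- ((t - c) * G t * sin (y * (t - c)))).
Proof.
rewrite /G; move: (gauss e (t - c)) => Gt; apply: is_derive_eq.
by rewrite /GRing.scale/=; ring.
Qed.

Let is_derive_siny (t y : R) : is_derive y (1 : R) (fun y => G t * sin (y * (t - c)))
  ((t - c) * G t * cos (y * (t - c))).
Proof.
rewrite /G; move: (gauss e (t - c)) => Gt; apply: is_derive_eq.
by rewrite /GRing.scale/=; ring.
Qed.

(** The majorant [K] serves every frequency, so any window around [y] would do; the one taken is []y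
    - 1, y + 1[]. *)
Let is_derive_under (f df : R -> R -> R) (K : R -> R) y :
  (forall y, integ leb (f y)) -> (forall t y, is_derive y (1 : R) (f ^~ t) (df y t)) ->
  (forall y t, `|df y t| <= K t) -> integ leb K ->
  is_derive y (1 : R) (fun y => \int[leb]_t f y t) (\int[leb]_t df y t).
Proof.
move=> fi dfE dfK Ki.
have pE y' t : partial1of2 f y' t = df y' t.
  by rewrite partial1of2E; have [] := dfE t y'.
have yI : `]y - 1, y + 1[%classic y by rewrite /= in_itv/= ltrBlDr ltrDl ltr01.
have K0 t : 0 <= K t by apply: le_trans (dfK 0 t).
have der y' t : derivable (f ^~ t) y' 1 by have [] := dfE t y'.
split.
  apply: (@derivable_under_integral R _ _ leb f setT measurableT y (y - 1) (y + 1)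
    yI _ _ K K0 Ki) => //.
  by move=> y' t _ _; rewrite pE.
rewrite -derive1E (@differentiation_under_integral R _ _ leb f setT measurableT y
  (y - 1) (y + 1) yI _ _ K K0 Ki)//.
  by apply: eq_Rintegral => t _; rewrite pE.
by move=> y' t _ _; rewrite pE.
Qed.

Let is_derive_cost (t y : R) : is_derive t (1 : R) (fun t => G t * cos (y * (t - c)))
  (- (e * (t - c)) * G t * cos (y * (t - c)) - y * (G t * sin (y * (t - c)))).
Proof.
have dG := is_derive_gauss e c t.
have dc : is_derive t (1 : R) (fun t => cos (y * (t - c))) (- y * sin (y * (t - c))).
  by apply: is_derive_eq; rewrite /GRing.scale/=; ring.
apply: (is_derive_eq (is_deriveM dG dc)).
by rewrite /GRing.scale/= /G; ring.
Qed.

Let is_derive_sint (t y : R) : is_derive t (1 : R) (fun t => G t * sin (y * (t - c)))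
  (- (e * (t - c)) * G t * sin (y * (t - c)) + y * (G t * cos (y * (t - c)))).
Proof.
have dG := is_derive_gauss e c t.
have dc : is_derive t (1 : R) (fun t => sin (y * (t - c))) (y * cos (y * (t - c))).
  by apply: is_derive_eq; rewrite /GRing.scale/=; ring.
apply: (is_derive_eq (is_deriveM dG dc)).
by rewrite /GRing.scale/= /G; ring.
Qed.

Let cG : continuous G. Proof. exact: continuous_gauss. Qed.

Let cmG : continuous (fun t => (t - c) * G t).
Proof.
by move=> t; apply: cvgM; [apply: cvgB; [exact: cvg_id|exact: cvg_cst]|exact: cG].
Qed.

Let clin y : continuous (fun t : R => y * (t - c)).
Proof. by move=> t; apply: cvgM; [exact: cvg_cst|apply: cvgB; [exact: cvg_id|exact: cvg_cst]]. Qed.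

Let ccos y : continuous (fun t : R => cos (y * (t - c))).
Proof. by move=> t; apply: (continuous_comp (@clin y t)); exact: continuous_cos. Qed.

Let csin y : continuous (fun t : R => sin (y * (t - c))).
Proof. by move=> t; apply: (continuous_comp (@clin y t)); exact: continuous_sin. Qed.

(** Differentiating under the integral, [A' y] is minus the integral of [(t - c) G sin]. The
    derivative of [G sin] in [t] has integral 0, which says that [e] times the former integral is
    [y * A y]. The same computation with [G cos] gives the equation of [B]. *)
Let is_derive_A y : is_derive y (1 : R) A (- (y / e) * A y).
Proof.
have h := @is_derive_under (fun y t => G t * cos (y * (t - c)))
  (fun y t => - ((t - c) * G t * sin (y * (t - c)))) _ y integGcos is_derive_cosy _ integ_moment.
apply: (is_derive_eq (h _)) => {h}.
  move=> y' t; rewrite normrN !normrM [X in _ * X * _]ger0_norm ?expR_ge0//.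
  apply: le_trans (gauss_moment_le (t - c)).
  by rewrite -[leRHS]mulr1 ler_wpM2l ?sin_max// mulr_ge0// expR_ge0.
have I1 := integZl (- e) (integ_mGsin y); have I2 := integZl y (integGcos y).
have fE : (fun t => - (e * (t - c)) * G t * sin (y * (t - c)) + y * (G t * cos (y * (t - c)))) =
    (fun t => - e * ((t - c) * G t * sin (y * (t - c))) + y * (G t * cos (y * (t - c)))).
  by apply/funext => t; ring.
have := @integral_derive_eq0 _ _ _ _ (fun t => is_derive_sint t y) _ _
  (fun t => gauss_moment_bound t (sin_max _)).
rewrite fE RintegralD// !RintegralZl// => H.
have {}H : - e * \int[leb]_t ((t - c) * G t * sin (y * (t - c))) + y * A y = 0.
  apply: H; last exact: integD.
  move=> t; apply: cvgD; apply: cvgM; try exact: cvg_cst.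
    by apply: cvgM; [exact: cmG|exact: csin].
  by apply: cvgM; [exact: cG|exact: ccos].
rewrite (_ : (fun t : R => - _) = fun t => -1 * ((t - c) * G t * sin (y * (t - c)))); last first.
  by apply/funext => t; ring.
rewrite RintegralZl//; apply: (mulfI (lt0r_neq0 e0)); rewrite -[LHS]subr0 -[in LHS]H.
by field; rewrite gt_eqF.
Qed.

Let is_derive_B y : is_derive y (1 : R) B (- (y / e) * B y).
Proof.
have h := @is_derive_under (fun y t => G t * sin (y * (t - c)))
  (fun y t => ((t - c) * G t * cos (y * (t - c)))) _ y integGsin is_derive_siny _ integ_moment.
apply: (is_derive_eq (h _)) => {h}.
  move=> y' t; rewrite !normrM [X in _ * X * _]ger0_norm ?expR_ge0//.
  apply: le_trans (gauss_moment_le (t - c)).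
  by rewrite -[leRHS]mulr1 ler_wpM2l ?cos_max// mulr_ge0// expR_ge0.
have I1 := integZl (- e) (integ_mGcos y); have I2 := integZl (- y) (integGsin y).
have fE : (fun t => - (e * (t - c)) * G t * cos (y * (t - c)) - y * (G t * sin (y * (t - c)))) =
    (fun t => - e * ((t - c) * G t * cos (y * (t - c))) + - y * (G t * sin (y * (t - c)))).
  by apply/funext => t; ring.
have := @integral_derive_eq0 _ _ _ _ (fun t => is_derive_cost t y) _ _
  (fun t => gauss_moment_bound t (cos_max _)).
rewrite fE RintegralD// !RintegralZl// => H.
have {}H : - e * \int[leb]_t ((t - c) * G t * cos (y * (t - c))) + - y * B y = 0.
  apply: H; last exact: integD.
  move=> t; apply: cvgD; apply: cvgM; try exact: cvg_cst.
    by apply: cvgM; [exact: cmG|exact: ccos].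
  by apply: cvgM; [exact: cG|exact: csin].
apply: (mulfI (lt0r_neq0 e0)); rewrite -[LHS]addr0 -[in LHS]H.
by field; rewrite gt_eqF.
Qed.

(** Integrating factor: [F] times the inverse of the expected Gaussian has derivative 0. *)
Let solve (F : R -> R) : (forall y, is_derive y (1 : R) F (- (y / e) * F y)) ->
  forall y, F y = F 0 * gauss e^-1 y.
Proof.
move=> dF y.
have dE (z : R) : is_derive z (1 : R) (fun z => F z * expR (e^-1 * z ^+ 2 / 2)) 0.
  have dx : is_derive z (1 : R) (fun z => expR (e^-1 * z ^+ 2 / 2))
      (z / e * expR (e^-1 * z ^+ 2 / 2)).
    apply: is_derive_eq; rewrite /GRing.scale/=; field.
    by rewrite gt_eqF.
  apply: (is_derive_eq (is_deriveM (dF z) dx)).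
  by rewrite /GRing.scale/=; ring.
have := is_derive_0_is_cst y 0 dE.
rewrite expr0n/= mulr0 mul0r expR0 mulr1 => <-.
by rewrite /gauss -mulrA -expRD subrr expR0 mulr1.
Qed.

Let A0 : A 0 = Num.sqrt (2 * pi / e).
Proof.
rewrite -(integral_gauss e0 c); apply: eq_Rintegral => t _.
by rewrite mul0r cos0 mulr1.
Qed.

Let B0 : B 0 = 0.
Proof.
rewrite /B; under eq_Rintegral do rewrite mul0r sin0 mulr0.
by rewrite Rintegral_cst// mul0r.
Qed.

(** The addition formula restores the uncentred phase. [B] vanishes since [B 0 = 0], and [A] is the
    Gaussian whose value at 0 is the total mass. *)
Lemma fourier_cos_gauss y : \int[leb]_t (gauss e (t - c) * cos (y * t)) =
  Num.sqrt (2 * pi / e) * gauss e^-1 y * cos (y * c).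
Proof.
transitivity (\int[leb]_t (cos (y * c) * (G t * cos (y * (t - c)))
    - sin (y * c) * (G t * sin (y * (t - c))))).
  apply: eq_Rintegral => t _; rewrite (_ : y * t = y * (t - c) + y * c) ?cosD /G; ring.
rewrite RintegralB//; try exact: integZl.
rewrite !RintegralZl// -/(A y) -/(B y) (solve is_derive_A) (solve is_derive_B) A0 B0.
by ring.
Qed.

Lemma fourier_sin_gauss y : \int[leb]_t (gauss e (t - c) * sin (y * t)) =
  Num.sqrt (2 * pi / e) * gauss e^-1 y * sin (y * c).
Proof.
transitivity (\int[leb]_t (sin (y * c) * (G t * cos (y * (t - c)))
    + cos (y * c) * (G t * sin (y * (t - c))))).
  apply: eq_Rintegral => t _; rewrite (_ : y * t = y * (t - c) + y * c) ?sinD /G; ring.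
rewrite RintegralD//; try exact: integZl.
rewrite !RintegralZl// -/(A y) -/(B y) (solve is_derive_A) (solve is_derive_B) A0 B0.
by ring.
Qed.

End gauss1_fourier.

(** * Product integrals *)

Section product_integrals.
Context d1 d2 (X : measurableType d1) (Y : measurableType d2) (R : realType).
Variables (m1 : {sigma_finite_measure set X -> \bar R})
  (m2 : {sigma_finite_measure set Y -> \bar R}).
Local Notation m12 := (m1 \x m2)%E.

Lemma integ_prodM (g : X -> R) (h : Y -> R) : integ m1 g -> integ m2 h ->
  integ m12 (fun z => g z.1 * h z.2).
Proof.
move=> gi hi.
have mf : measurable_fun setT (EFin \o (fun z : X * Y => g z.1 * h z.2)).
  apply/measurable_EFinP; apply: measurable_funM.
    exact: measurableT_comp (integ_measurable gi) measurable_fst.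
  exact: measurableT_comp (integ_measurable hi) measurable_snd.
apply/(integrable12ltyP _ _ mf) => /=.
have hfin : (\int[m2]_y `|(h y)%:E|)%E \is a fin_num.
  by apply: (integrable_fin_num _ (integrable_norm hi)).
under eq_integral => x _.
  under eq_integral do rewrite normrM EFinM.
  rewrite ge0_integralZl//; last first.
    by apply/measurable_EFinP; apply: measurableT_comp => //; exact: integ_measurable hi.
  over.
rewrite ge0_integralZr//; last 2 first.
- by apply/measurable_EFinP; apply: measurableT_comp => //; exact: integ_measurable gi.
- by apply: integral_ge0.
have gfin : (\int[m1]_y `|(g y)%:E|)%E \is a fin_num.
  by apply: (integrable_fin_num _ (integrable_norm gi)).
by rewrite -(fineK hfin) -(fineK gfin) -EFinM ltry.
Qed.

(* An infinite Rintegral is 0; integrability of every section, rather than almost every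
   one, rules this case out below. *)
Variable f : X -> Y -> R.
Hypothesis fi : integ m12 (fun z => f z.1 z.2).
Hypothesis fx : forall x, integ m2 (f x).

Lemma measurable_Rintegral_prod : measurable_fun setT (fun x => \int[m2]_y f x y).
Proof.
apply/measurable_EFinP.
have := measurable_fubini_F fi; congr measurable_fun.
by apply/funext => x; rewrite /fubini_F /= EFin_Rintegral.
Qed.

Lemma integ_Rintegral_prod : integ m1 (fun x => \int[m2]_y f x y).
Proof.
have := integrable_fubini_F fi; congr integrable.
by apply/funext => x; rewrite /fubini_F /= EFin_Rintegral.
Qed.

Lemma Rintegral_prod : \int[m12]_z f z.1 z.2 = \int[m1]_x \int[m2]_y f x y.
Proof.
rewrite /Rintegral; congr fine; rewrite -(integral12_prod_meas1 fi)//.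
by apply: eq_integral => x _; rewrite EFin_Rintegral.
Qed.

Hypothesis fy : forall y, integ m1 (f ^~ y).

Lemma Rfubini : \int[m1]_x \int[m2]_y f x y = \int[m2]_y \int[m1]_x f x y.
Proof.
rewrite -Rintegral_prod /Rintegral; congr fine; rewrite -(integral21_prod_meas1 fi)//.
by apply: eq_integral => x _; rewrite EFin_Rintegral.
Qed.

End product_integrals.

(** Both product measures test integrability on the same iterated integral of [|f|], which is one
    order for [m1 \x m2] and the other order for [m2 \x m1]. *)
Lemma integ_swap d1 d2 (X : measurableType d1) (Y : measurableType d2) (R : realType)
  (m1 : {sigma_finite_measure set X -> \bar R})
  (m2 : {sigma_finite_measure set Y -> \bar R}) (f : X -> Y -> R) :
  integ (m1 \x m2)%E (fun z => f z.1 z.2) -> integ (m2 \x m1)%E (fun z => f z.2 z.1).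
Proof.
move=> fi; have mf := measurable_int _ fi.
have mfs : measurable_fun setT (EFin \o (fun z : Y * X => f z.2 z.1)).
  exact: (measurableT_comp mf (measurable_swap (T1 := Y) (T2 := X))).
by apply/(integrable21ltyP _ _ mfs); move/(integrable12ltyP _ _ mf) : fi.
Qed.

Lemma Rintegral_prodM d1 d2 (X : measurableType d1) (Y : measurableType d2)
  (R : realType) (m1 : {sigma_finite_measure set X -> \bar R})
  (m2 : {sigma_finite_measure set Y -> \bar R}) (g : X -> R) (h : Y -> R) :
  integ m1 g -> integ m2 h ->
  \int[(m1 \x m2)%E]_z (g z.1 * h z.2) = \int[m1]_x g x * \int[m2]_y h y.
Proof.
move=> gi hi; rewrite (@Rintegral_prod _ _ _ _ _ _ _ (fun x y => g x * h y)).
- under eq_Rintegral do rewrite RintegralZl//.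
  by rewrite RintegralZr.
- exact: integ_prodM.
- by move=> x; exact: integZl.
Qed.

(** * From the line to row vectors: products over the coordinates *)

Section rV_integrals.
Variable R : realType.
Local Notation leb := (@lebesgue_measure R).
Local Notation mu n := (lebesgue_rV R n).

Definition rV_tail n (v : 'rV[R]_n.+1) : 'rV[R]_n := \row_i v ord0 (lift ord0 i).

Section tensor.
Variables (n : nat) (g : R -> R) (h : 'rV[R]_n -> R).
Hypotheses (gi : integ leb g) (hi : integ (mu n) h).

Let f (v : 'rV[R]_n.+1) := g (v ord0 ord0) * h (rV_tail v).

Let mf : measurable_fun setT f.
Proof.
apply: measurable_funM.
  apply: (measurableT_comp (f := g)); first exact: integ_measurable gi.
  exact: measurable_coord.
apply: (measurableT_comp (f := h)); first exact: integ_measurable hi.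
by apply/measurable_fun_rVP => i; under eq_fun do rewrite mxE; exact: measurable_coord.
Qed.

Let fE : f \o @rV_cons R n = fun z => g z.1 * h z.2.
Proof.
apply/funext => -[x v]; rewrite /f /= mxE unlift_none /=; congr (_ * h _).
by apply/rowP => i; rewrite !mxE liftK.
Qed.

(** [mu n.+1] is by definition the image of [leb \x mu n] under [rV_cons], along which the first
    coordinate and the tail separate. *)
Lemma integ_tensor : integ (mu n.+1) f.
Proof.
apply: (@integrable_pushforward _ _ _ _ R (@rV_cons R n) (@measurable_rV_cons R n)
  (leb \x mu n)%E setT (EFin \o f)) => //; first exact/measurable_EFinP.
rewrite preimage_setT (_ : _ \o _ = EFin \o (f \o @rV_cons R n))// fE.
exact: integ_prodM.
Qed.

Lemma Rintegral_tensor : \int[mu n.+1]_v f v = \int[leb]_x g x * \int[mu n]_v h v.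
Proof.
rewrite -(Rintegral_prodM gi hi) /Rintegral; congr fine.
rewrite [LHS](@integral_pushforward _ _ _ _ R (@rV_cons R n) (@measurable_rV_cons R n)
  (leb \x mu n)%E setT (EFin \o f))//.
- by rewrite preimage_setT (_ : _ \o _ = EFin \o (f \o @rV_cons R n))// fE.
- exact/measurable_EFinP.
- rewrite preimage_setT (_ : _ \o _ = EFin \o (f \o @rV_cons R n))// fE.
  exact: integ_prodM.
Qed.

End tensor.

Lemma integ_rV_prod n (g : 'I_n -> R -> R) : (forall i, integ leb (g i)) ->
  integ (mu n) (fun v => \prod_(i < n) g i (v ord0 i)).
Proof.
elim: n g => [|n IH] g gi.
  rewrite (_ : (fun _ => _) = cst 1); last by apply/funext => v; rewrite big_ord0.
  by apply: finite_measure_integrable_cst.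
have := integ_tensor (gi ord0) (IH (fun i => g (lift ord0 i)) (fun i => gi _)).
congr integrable; apply/funext => v /=; rewrite big_ord_recl; congr (_ * _)%:E.
by apply: eq_bigr => i _; rewrite mxE.
Qed.

Lemma measurable_rV_dot n (y : 'rV[R]_n) : measurable_fun setT (rV_dot y).
Proof.
apply: measurable_sum => i; apply: measurable_funM => //; exact: measurable_coord.
Qed.

(** The hypotheses give each one-dimensional Fourier integral in polar form, with amplitude [G i]
    and phase [th i]. Amplitudes multiply and phases add, as for complex numbers; cosine and sine
    share one induction because the addition formulas mix them. *)
Lemma Rintegral_rV_cos_sin n (g : 'I_n -> R -> R) (y : 'rV[R]_n) (G th : 'I_n -> R) :
  (forall i, integ leb (g i)) ->
  (forall i, \int[leb]_t (g i t * cos (y ord0 i * t)) = G i * cos (th i)) ->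
  (forall i, \int[leb]_t (g i t * sin (y ord0 i * t)) = G i * sin (th i)) ->
  \int[mu n]_v ((\prod_(i < n) g i (v ord0 i)) * cos (rV_dot y v)) =
    (\prod_(i < n) G i) * cos (\sum_(i < n) th i) /\
  \int[mu n]_v ((\prod_(i < n) g i (v ord0 i)) * sin (rV_dot y v)) =
    (\prod_(i < n) G i) * sin (\sum_(i < n) th i).
Proof.
elim: n g y G th => [|n IH] g y G th gi gc gs.
  rewrite !big_ord0 !mul1r.
  have E (F : R -> R) : \int[mu 0]_v ((\prod_(i < 0) g i (v ord0 i)) * F (rV_dot y v)) = F 0.
    under eq_Rintegral do rewrite /rV_dot !big_ord0 mul1r.
    by rewrite Rintegral_cst//= indicE in_setT mulr1.
  by rewrite !E.
pose yt := rV_tail y.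
have [IHc IHs] := IH (fun i => g (lift ord0 i)) yt (fun i => G (lift ord0 i))
  (fun i => th (lift ord0 i)) (fun i => gi _)
  (fun i => ltac:(rewrite mxE; exact: gc)) (fun i => ltac:(rewrite mxE; exact: gs)).
pose P (v : 'rV[R]_n) := \prod_(i < n) g (lift ord0 i) (v ord0 i).
have PE (v : 'rV[R]_n.+1) : \prod_(i < n.+1) g i (v ord0 i) = g ord0 (v ord0 ord0) * P (rV_tail v).
  by rewrite big_ord_recl; congr (_ * _); apply: eq_bigr => i _; rewrite mxE.
have dotE (v : 'rV[R]_n.+1) : rV_dot y v = y ord0 ord0 * v ord0 ord0 + rV_dot yt (rV_tail v).
  by rewrite /rV_dot big_ord_recl; congr (_ + _); apply: eq_bigr => i _; rewrite !mxE.
have Pi : integ (mu n) P by apply: (@integ_rV_prod _ (fun i => g (lift ord0 i))) => i.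
have cosi : integ (mu n) (fun v => P v * cos (rV_dot yt v)).
  apply: (integMb (M := 1)) => // [|x]; last exact: cos_max.
  apply: measurableT_comp (measurable_rV_dot yt).
  by apply: continuous_measurable_fun; exact: continuous_cos.
have sini : integ (mu n) (fun v => P v * sin (rV_dot yt v)).
  apply: (integMb (M := 1)) => // [|x]; last exact: sin_max.
  apply: measurableT_comp (measurable_rV_dot yt).
  by apply: continuous_measurable_fun; exact: continuous_sin.
have mlin : measurable_fun setT (fun t : R => y ord0 ord0 * t).
  exact: measurable_funM.
have gcosi : integ leb (fun t => g ord0 t * cos (y ord0 ord0 * t)).
  apply: (integMb (M := 1)) => // [|x]; last exact: cos_max.
  apply: measurableT_comp mlin.
  by apply: continuous_measurable_fun; exact: continuous_cos.
have gsini : integ leb (fun t => g ord0 t * sin (y ord0 ord0 * t)).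
  apply: (integMb (M := 1)) => // [|x]; last exact: sin_max.
  apply: measurableT_comp mlin.
  by apply: continuous_measurable_fun; exact: continuous_sin.
rewrite !big_ord_recl cosD sinD; split.
  transitivity (\int[mu n.+1]_v
    ((g ord0 (v ord0 ord0) * cos (y ord0 ord0 * v ord0 ord0)) *
       (P (rV_tail v) * cos (rV_dot yt (rV_tail v)))
    - (g ord0 (v ord0 ord0) * sin (y ord0 ord0 * v ord0 ord0)) *
       (P (rV_tail v) * sin (rV_dot yt (rV_tail v))))).
    by apply: eq_Rintegral => v _; rewrite PE dotE cosD; ring.
  rewrite RintegralB//; [|exact: integ_tensor gcosi cosi|exact: integ_tensor gsini sini].
  rewrite (Rintegral_tensor gcosi cosi) (Rintegral_tensor gsini sini).
  by rewrite IHc IHs gc gs; ring.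
transitivity (\int[mu n.+1]_v
    ((g ord0 (v ord0 ord0) * sin (y ord0 ord0 * v ord0 ord0)) *
       (P (rV_tail v) * cos (rV_dot yt (rV_tail v)))
    + (g ord0 (v ord0 ord0) * cos (y ord0 ord0 * v ord0 ord0)) *
       (P (rV_tail v) * sin (rV_dot yt (rV_tail v))))).
  by apply: eq_Rintegral => v _; rewrite PE dotE sinD; ring.
rewrite RintegralD//; [|exact: integ_tensor gsini cosi|exact: integ_tensor gcosi sini].
rewrite (Rintegral_tensor gsini cosi) (Rintegral_tensor gcosi sini).
by rewrite IHc IHs gc gs; ring.
Qed.

End rV_integrals.

(** * Square integrable functions *)

Section fatou_bound.
Context d (T : measurableType d) (R : realType).
Variable mu : {measure set T -> \bar R}.

(** Integrability of the limit belongs to the conclusion: L^2 limits and transforms acquire their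
    square integrability here. *)
Lemma Rfatou_le (F_ : nat -> T -> R) (F : T -> R) (M : R) :
  (forall k, integ mu (F_ k)) -> measurable_fun setT F ->
  (forall k x, 0 <= F_ k x) -> (forall x, 0 <= F x) ->
  {ae mu, forall x, F_ k x @[k --> \oo] --> F x} ->
  (\forall k \near \oo, \int[mu]_x F_ k x <= M) ->
  integ mu F /\ \int[mu]_x F x <= M.
Proof.
move=> iF mF F_0 F0 cF FM.
have mF_ k : measurable_fun setT (EFin \o F_ k) by exact: measurable_int (iF k).
have h : (\int[mu]_x (F x)%:E <= M%:E)%E.
  rewrite (@ae_eq_integral _ _ _ mu setT (fun x => limn_einf (fun k => (F_ k x)%:E)))//; last 3 first.
  - exact/measurable_EFinP.
  - rewrite /limn_einf; apply: measurableT_comp => //.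
    apply: measurable_fun_limn_esup => k; apply: (measurableT_comp (f := -%E)) => //; exact: mF_.
  - apply: filterS cF => x Fx _.
    have Fx' : (F_ k x)%:E @[k --> \oo] --> (F x)%:E.
      by apply: cvg_EFin => //; exact: nearW.
    by rewrite is_cvg_limn_einfE//; [rewrite (cvg_lim _ Fx')|apply/cvg_ex; exists (F x)%:E].
  apply: le_trans (fatou mu measurableT mF_ _) _; first by move=> k x _; rewrite lee_fin.
  rewrite limn_einf_lim; apply: lime_le; first exact: is_cvg_einfs.
  case: FM => N _ FM; apply: nearW => k.
  (* The bound holds from [N] on only, so the infimum over the indices from [k] on is compared with
     the term at [maxn k N]. *)
  apply: (@le_trans _ _ (\int[mu]_x (F_ (maxn k N) x)%:E)%E).
    by apply: ereal_inf_lbound; exists (maxn k N) => //=; exact: leq_maxl.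
  by rewrite -EFin_Rintegral// lee_fin FM//= leq_maxr.
have iFF : integ mu F.
  apply/integrableP; split; first exact/measurable_EFinP.
  under eq_integral do rewrite /= ger0_norm//.
  exact: le_lt_trans h (ltry _).
by split=> //; rewrite -lee_fin EFin_Rintegral.
Qed.

End fatou_bound.

Section square_integrable.
Context d (T : measurableType d) (R : realType).
Variable mu : {measure set T -> \bar R}.
Implicit Types f g : T -> R.

Definition sqinteg f := measurable_fun setT f /\ integ mu (fun x => f x ^+ 2).

Lemma sqinteg_mul f g : sqinteg f -> sqinteg g -> integ mu (fun x => f x * g x).
Proof.
move=> [mf fi] [mg gi]; apply: (integ_le _ _ (integD fi gi)).
  exact: measurable_funM.
move=> x; rewrite normrM -(real_normK (num_real (f x))) -(real_normK (num_real (g x))).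
have := sqr_ge0 (`|f x| - `|g x|); have := normr_ge0 (f x); have := normr_ge0 (g x); nra.
Qed.

Lemma sqintegZ a f : sqinteg f -> sqinteg (fun x => a * f x).
Proof.
move=> [mf fi]; split; first exact: measurable_funM.
have := integZl (a ^+ 2) fi; congr (integrable _ _ _).
by apply/funext => x /=; rewrite exprMn.
Qed.

Lemma sqintegD f g : sqinteg f -> sqinteg g -> sqinteg (fun x => f x + g x).
Proof.
move=> hf hg; have [mf fi] := hf; have [mg gi] := hg.
split; first exact: measurable_funD.
have := integD (integD fi gi) (integZl 2 (sqinteg_mul hf hg)); congr (integrable _ _ _).
by apply/funext => x /=; congr EFin; ring.
Qed.

Lemma sqintegB f g : sqinteg f -> sqinteg g -> sqinteg (fun x => f x - g x).
Proof.
move=> hf hg; rewrite (_ : (fun x => _) = fun x => f x + -1 * g x).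
  by apply: sqintegD => //; exact: sqintegZ.
by apply/funext => x; rewrite mulN1r.
Qed.

Lemma sqintegMb f g M : sqinteg f -> measurable_fun setT g -> (forall x, `|g x| <= M) ->
  sqinteg (fun x => f x * g x).
Proof.
move=> [mf fi] mg gM; split; first exact: measurable_funM.
rewrite (_ : (fun x => _) = fun x => f x ^+ 2 * g x ^+ 2); last first.
  by apply/funext => x; rewrite exprMn.
apply: (integMb (M := M ^+ 2) fi); first exact: measurable_funX.
by move=> x; rewrite normrX lerXn2r ?nnegrE ?(le_trans _ (gM x)).
Qed.

(** Young's inequality with a free weight, from [t^-1 (t |f| - |g|)^2 >= 0]. A suitable choice of
    [t] plays the part of the Cauchy-Schwarz inequality. *)
Lemma integral_mul_le f g t : 0 < t -> sqinteg f -> sqinteg g ->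
  2 * `|\int[mu]_x (f x * g x)| <= t * \int[mu]_x f x ^+ 2 + t^-1 * \int[mu]_x g x ^+ 2.
Proof.
move=> t0 hf hg; have [mf fi] := hf; have [mg gi] := hg.
have fgi := sqinteg_mul hf hg.
apply: (@le_trans _ _ (2 * \int[mu]_x `|f x * g x|)).
  by rewrite ler_wpM2l// le_normr_Rintegral.
rewrite -!RintegralZl//; last exact: integrable_norm.
rewrite -RintegralD//; try exact: integZl.
apply: le_Rintegral => //.
- by apply: integZl; exact: integrable_norm.
- by apply: integD; exact: integZl.
move=> x _; rewrite normrM -(real_normK (num_real (f x))) -(real_normK (num_real (g x))).
rewrite -subr_ge0.
rewrite (_ : _ - _ = t^-1 * (t * `|f x| - `|g x|) ^+ 2).
  by rewrite mulr_ge0 ?invr_ge0 ?sqr_ge0 ?ltW.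
by field; rewrite gt_eqF.
Qed.

Lemma integral_sqr_eq0 f : sqinteg f -> \int[mu]_x f x ^+ 2 <= 0 -> f = cst 0 %[ae mu].
Proof.
move=> [mf fi] f0.
have mf2 : measurable_fun setT (EFin \o (fun x => f x ^+ 2)) by exact: measurable_int fi.
have /(ae_eq_integral_abs mu measurableT mf2).1 : (\int[mu]_x `|(f x ^+ 2)%:E| = 0)%E.
  under eq_integral do rewrite /= ger0_norm ?sqr_ge0//.
  rewrite -EFin_Rintegral//; congr EFin; apply/eqP; rewrite eq_le f0/=.
  by apply: Rintegral_ge0 => x _; exact: sqr_ge0.
apply: filterS => x /(_ I) /= [] /eqP; rewrite sqrf_eq0 => /eqP fx _; exact: fx.
Qed.

End square_integrable.

Section L2_completeness.
Context d (T : measurableType d) (R : realType).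
Variable mu : {measure set T -> \bar R}.

(** The increments are at most [sqrt C / 2^j] in absolute value, so the telescoping series converges
    absolutely. *)
Lemma cvg_geometric_increments (u : nat -> R) (C : R) :
  (forall j, 4 ^+ j * (u j.+1 - u j) ^+ 2 <= C) -> cvgn u.
Proof.
move=> uC.
have C0 : 0 <= C by apply: le_trans (uC 0%N); rewrite mulr_ge0 ?sqr_ge0 ?exprn_ge0.
have tel : cvgn (series (telescope u)).
  apply: normed_cvg.
  apply: (@series_le_cvg _ _ (geometric (Num.sqrt C) 2^-1)) => [j|j|j|].
  - exact: normr_ge0.
  - by rewrite /geometric /= mulr_ge0 ?sqrtr_ge0// exprn_ge0// invr_ge0.
  - rewrite /geometric /= exprVn ler_pdivlMr ?exprn_gt0//.
    rewrite -(@ler_pXn2r _ 2)// ?nnegrE ?mulr_ge0 ?exprn_ge0 ?sqrtr_ge0//.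
    rewrite exprMn sqr_sqrtr// real_normK ?num_real// mulrC.
    have E4 : 4 ^+ j = (2 ^+ j) ^+ 2 :> R by rewrite exprAC; congr (_ ^+ _); ring.
    by rewrite -E4; exact: uC.
  - by apply: is_cvg_geometric_series; rewrite ger0_norm ?invr_ge0// invf_lt1// ltr1n.
rewrite (_ : u = fun j => u 0%N + series (telescope u) j).
  by apply: is_cvgD => //; exact: is_cvg_cst.
by apply/funext => j; exact: eq_sum_telescope.
Qed.

(** Riesz-Fischer. Along a subsequence the squared increments have integral at most [8^-j]; the
    weight [4^j] makes the increments geometric at almost every point and still leaves the summable
    [2^-j]. Fatou's lemma then turns pointwise convergence of the subsequence into L^2 convergence
    of the whole sequence. *)
Lemma L2_complete (f : nat -> T -> R) :
  (forall k, sqinteg mu (f k)) ->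
  (forall e : R, 0 < e -> exists N, forall k l, (N <= k)%N -> (N <= l)%N ->
     \int[mu]_x (f k x - f l x) ^+ 2 <= e) ->
  exists2 F, sqinteg mu F & forall e : R, 0 < e ->
     exists N, forall k, (N <= k)%N -> \int[mu]_x (f k x - F x) ^+ 2 <= e.
Proof.
move=> fi fc.
have e8 j : 0 < 8^-1 ^+ j :> R by rewrite exprn_gt0// invr_gt0.
pose phi j := maxn (sval (cid (fc _ (e8 j)))) j.
have phiP j k l : (phi j <= k)%N -> (phi j <= l)%N ->
    \int[mu]_x (f k x - f l x) ^+ 2 <= 8^-1 ^+ j.
  by rewrite !geq_max => /andP[? _] /andP[? _]; exact: (svalP (cid (fc _ (e8 j)))).
(* The running maximum is nondecreasing, so [psi j] and [psi j.+1] both lie beyond [phi j]; the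
   [maxn _ j] in [phi] makes [psi] tend to infinity. *)
pose psi j := (\max_(i < j.+1) phi i)%N.
have psi_phi j : (phi j <= psi j)%N by exact: (@leq_bigmax _ (fun i : 'I_j.+1 => phi i) ord_max).
have psi_mono i j : (i <= j)%N -> (psi i <= psi j)%N.
  move=> ij; apply/bigmax_leqP => k _.
  have kj : (k < j.+1)%N by apply: leq_trans (ltn_ord k) _.
  exact: (@leq_bigmax _ (fun i : 'I_j.+1 => phi i) (Ordinal kj)).
pose D j x := f (psi j.+1) x - f (psi j) x.
have DS j : sqinteg mu (D j) by exact: sqintegB.
have Dle j : \int[mu]_x (D j x ^+ 2) <= 8^-1 ^+ j.
  by apply: phiP => //; apply: leq_trans (psi_phi j) _; exact: psi_mono.
pose W j x : \bar R := (4 ^+ j * D j x ^+ 2)%:E.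
have W0 j x : (0 <= W j x)%E by rewrite lee_fin mulr_ge0 ?sqr_ge0 ?exprn_ge0.
have iW j : integ mu (fun x => 4 ^+ j * D j x ^+ 2) by apply: integZl; case: (DS j).
have mW j : measurable_fun setT (W j) by exact: measurable_int (iW j).
have SW : (\int[mu]_x (\sum_(0 <= j <oo) W j x) < +oo)%E.
  rewrite integral_nneseries//; apply: (@le_lt_trans _ _ 2%:E); last exact: ltry.
  apply: lime_le; first by apply: is_cvg_nneseries => j _ _; exact: integral_ge0.
  apply: nearW => k.
  (* The exact value of the geometric sum, in place of its bound 2, lets the induction close. *)
  suff : (\sum_(0 <= j < k) \int[mu]_x W j x <= (2 - 2 * 2^-1 ^+ k)%:E)%E.
    move/le_trans; apply; rewrite lee_fin gerBl mulr_ge0// exprn_ge0// invr_ge0//.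
  elim: k => [|k IH]; first by rewrite big_nil lee_fin expr0 mulr1 subrr.
  rewrite big_nat_recr//=; apply: le_trans (leeD2r _ IH) _.
  rewrite -EFin_Rintegral// -EFinD lee_fin RintegralZl//; last by case: (DS k).
  apply: (@le_trans _ _ (2 - 2 * 2^-1 ^+ k + 4 ^+ k * 8^-1 ^+ k)).
    by rewrite lerD2l ler_wpM2l ?exprn_ge0.
  rewrite -exprMn (_ : 4 * 8^-1 = 2^-1 :> R); last by field.
  by rewrite exprS; lra.
have aeC : {ae mu, forall x, cvgn (fun j => f (psi j) x)}.
  have iSW : mu.-integrable setT (fun x => (\sum_(0 <= j <oo) W j x)%E).
    apply/integrableP; split.
      by apply: ge0_emeasurable_sum.
    under eq_integral do rewrite gee0_abs ?nneseries_ge0//.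
    exact: SW.
  apply: filterS (integrable_ae measurableT iSW) => x /(_ I) Wfin.
  apply: (@cvg_geometric_increments _ (fine (\sum_(0 <= j <oo) W j x))) => j.
  rewrite -lee_fin fineK//; apply: le_trans (nneseries_lim_ge j.+1 _) => //.
  by rewrite big_nat_recr//= leeDr// sume_ge0.
(* The upper limit is measurable on the whole space and agrees with the limit wherever there is
   one. *)
pose F x := fine (limn_esup (fun j => (f (psi j) x)%:E)).
have mF : measurable_fun setT F.
  apply: measurableT_comp => //.
  apply: measurable_fun_limn_esup => j; apply/measurable_EFinP; by case: (fi (psi j)).
have aeF : {ae mu, forall x, f (psi j) x @[j --> \oo] --> F x}.
  apply: filterS aeC => x /cvg_ex[l xl].
  suff -> : F x = l by [].
  have xl' : (f (psi j) x)%:E @[j --> \oo] --> l%:E by apply: cvg_EFin => //; exact: nearW.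
  by rewrite /F is_cvg_limn_esupE ?(cvg_lim _ xl')//; apply/cvg_ex; exists l%:E.
have psi_ge N : \forall j \near \oo, (N <= psi j)%N.
  exists N => // j /= Nj; apply: leq_trans Nj _; apply: leq_trans (psi_phi j).
  exact: leq_maxr.
have key (e : R) : 0 < e -> exists N, forall k, (N <= k)%N ->
    integ mu (fun x => (f k x - F x) ^+ 2) /\ \int[mu]_x (f k x - F x) ^+ 2 <= e.
  move=> e0; have [N HN] := fc e e0; exists N => k Nk.
  apply: (@Rfatou_le _ _ _ mu (fun j x => (f k x - f (psi j) x) ^+ 2)).
  - by move=> j; case: (sqintegB (fi k) (fi (psi j))).
  - by apply: measurable_funX; apply: measurable_funB => //; case: (fi k).
  - by move=> j x; exact: sqr_ge0.
  - by move=> x; exact: sqr_ge0.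
  - apply: filterS aeF => x xF; apply: cvgM; apply: cvgB => //; exact: cvg_cst.
  - by apply: filterS (psi_ge N) => j Nj; exact: HN.
exists F.
  have [N /(_ N (leqnn N))[iFN _]] := key 1 ltr01.
  have h : sqinteg mu (fun x => f N x - F x).
    by split=> //; apply: measurable_funB => //; case: (fi N).
  have := sqintegB (fi N) h; congr sqinteg; apply/funext => x; by rewrite subKr.
by move=> e e0; have [N HN] := key e e0; exists N => k /HN[].
Qed.
End L2_completeness.

(** * The transform of integrable functions *)

Section real_fourier_L1.
Variables (R : realType) (n : nat).
Local Notation leb := (@lebesgue_measure R).
Local Notation mu := (lebesgue_rV R n).
Local Notation H := (@real_fourier R n).
Implicit Types f g : 'rV[R]_n -> R.
Implicit Types x y c : 'rV[R]_n.

(** The kernel of [real_fourier]: Hartley's kernel up to the sign of the sine. *)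
Definition cas (t : R) : R := cos t - sin t.

Lemma cas_bound t : `|cas t| <= 2.
Proof.
by rewrite (le_trans (ler_normB _ _))// (_ : 2 = 1 + 1)// lerD ?cos_max ?sin_max.
Qed.

Lemma measurable_cas : measurable_fun setT cas.
Proof.
by apply: measurable_funB; apply: continuous_measurable_fun;
  [exact: continuous_cos|exact: continuous_sin].
Qed.

Lemma rV_dotC x y : rV_dot x y = rV_dot y x.
Proof. by apply: eq_bigr => i _; rewrite mulrC. Qed.

Definition gaussn e c x := \prod_(i < n) gauss e (x ord0 i - c ord0 i).

Lemma gaussnE e c x :
  gaussn e c x = expR (- (e * (\sum_(i < n) (x ord0 i - c ord0 i) ^+ 2) / 2)).
Proof.
rewrite mulr_sumr mulr_suml -sumrN expR_sum; exact: eq_bigr.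
Qed.

Lemma gaussn_ge0 e c x : 0 <= gaussn e c x.
Proof. by apply: prodr_ge0 => i _; exact: expR_ge0. Qed.

Lemma gaussn_le1 e c x : 0 < e -> gaussn e c x <= 1.
Proof. by move=> e0; apply: prodr_ile1 => i _; rewrite expR_ge0 gauss_le1. Qed.

Lemma gaussn_norm_le1 e c x : 0 < e -> `|gaussn e c x| <= 1.
Proof. by move=> e0; rewrite ger0_norm ?gaussn_ge0// gaussn_le1. Qed.

Lemma gaussnC e c x : gaussn e c x = gaussn e x c.
Proof. by apply: eq_bigr => i _; rewrite -gaussN opprB. Qed.

Lemma integ_gaussn e c : 0 < e -> integ mu (gaussn e c).
Proof.
move=> e0; apply: (@integ_rV_prod R n (fun i t => gauss e (t - c ord0 i))) => i.
exact: integ_gauss.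
Qed.

Lemma measurable_gaussn e c : 0 < e -> measurable_fun setT (gaussn e c).
Proof. by move=> e0; exact: integ_measurable (integ_gaussn c e0). Qed.

Lemma measurable_cas_dot y : measurable_fun setT (fun x => cas (rV_dot y x)).
Proof. exact: measurableT_comp measurable_cas (measurable_rV_dot y). Qed.

(** Pairing a function with [wave e c] evaluates at [c], up to the constant factor, the transform of
    that function damped by [gaussn e 0]. *)
Definition wave e c y := gaussn e 0 y * cas (rV_dot y c).

Lemma integ_wave e c : 0 < e -> integ mu (wave e c).
Proof.
move=> e0; apply: (integMb (M := 2)); first exact: integ_gaussn.
  by under eq_fun do rewrite rV_dotC; exact: measurable_cas_dot.
by move=> x; exact: cas_bound.
Qed.

Lemma integral_gaussn_cos_sin e c y : 0 < e ->
  \int[mu]_x (gaussn e c x * cos (rV_dot y x)) =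
    Num.sqrt (2 * pi / e) ^+ n * gaussn e^-1 0 y * cos (rV_dot y c) /\
  \int[mu]_x (gaussn e c x * sin (rV_dot y x)) =
    Num.sqrt (2 * pi / e) ^+ n * gaussn e^-1 0 y * sin (rV_dot y c).
Proof.
move=> e0.
have [hc hs] := @Rintegral_rV_cos_sin R n (fun i t => gauss e (t - c ord0 i)) y
  (fun i => Num.sqrt (2 * pi / e) * gauss e^-1 (y ord0 i)) (fun i => y ord0 i * c ord0 i)
  (fun i => integ_gauss e0 _) (fun i => fourier_cos_gauss e0 _ _)
  (fun i => fourier_sin_gauss e0 _ _).
have E : \prod_(i < n) (Num.sqrt (2 * pi / e) * gauss e^-1 (y ord0 i)) =
    Num.sqrt (2 * pi / e) ^+ n * gaussn e^-1 0 y.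
  rewrite big_split /= prodr_const card_ord; congr (_ * _).
  by apply: eq_bigr => i _; rewrite mxE subr0.
by rewrite -E.
Qed.

Lemma integral_gaussn e c : 0 < e -> \int[mu]_x gaussn e c x = Num.sqrt (2 * pi / e) ^+ n.
Proof.
move=> e0; have [+ _] := integral_gaussn_cos_sin c 0 e0.
have d0 x : rV_dot 0 x = 0 by rewrite /rV_dot big1// => i _; rewrite mxE mul0r.
rewrite d0 cos0 mulr1; under eq_Rintegral do rewrite d0 cos0 mulr1.
move=> ->; rewrite /gaussn big1 ?mulr1// => i _.
by rewrite subrr /gauss expr0n/= mulr0 mul0r oppr0 expR0.
Qed.

Lemma real_fourier_const : (Num.sqrt ((2 * pi) ^+ n))^-1 = (Num.sqrt (2 * pi) ^+ n)^-1 :> R.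
Proof.
by congr (_^-1); elim: n => [|m IH]; rewrite ?expr0 ?sqrtr1// !exprS sqrtrM ?IH// mulr_ge0// pi_ge0.
Qed.

Lemma real_fourier_const_gt0 : 0 < Num.sqrt ((2 * pi) ^+ n) :> R.
Proof. by rewrite sqrtr_gt0 exprn_gt0// mulr_gt0// pi_gt0. Qed.

Lemma sqrt2pi_gt0 : 0 < Num.sqrt (2 * pi) :> R.
Proof. by rewrite sqrtr_gt0 mulr_gt0// pi_gt0. Qed.

Lemma sqrt2pi_div e : 0 < e -> Num.sqrt (2 * pi / e) = Num.sqrt (2 * pi) / Num.sqrt e :> R.
Proof. by move=> e0; rewrite sqrtrM ?sqrtrV// ?mulr_ge0// ?pi_ge0// ltW. Qed.

Lemma real_fourier_gaussn c : H (gaussn 1 c) = wave 1 c.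
Proof.
apply/funext => y; rewrite /real_fourier real_fourier_const.
have [hc hs] := integral_gaussn_cos_sin c y (@ltr01 R).
under eq_Rintegral do rewrite mulrBr.
rewrite RintegralB//; last 2 first.
- apply: (integMb (M := 1)) => [||x]; [exact: integ_gaussn| |exact: cos_max].
  apply: measurableT_comp (measurable_rV_dot y).
  by apply: continuous_measurable_fun; exact: continuous_cos.
- apply: (integMb (M := 1)) => [||x]; [exact: integ_gaussn| |exact: sin_max].
  apply: measurableT_comp (measurable_rV_dot y).
  by apply: continuous_measurable_fun; exact: continuous_sin.
rewrite hc hs invr1 mulr1 /wave /cas -mulrBr !mulrA mulVf ?mul1r//.
by rewrite expf_neq0// gt_eqF// sqrt2pi_gt0.
Qed.

Lemma rV_dotDl x y z : rV_dot (x + y) z = rV_dot x z + rV_dot y z.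
Proof. by rewrite /rV_dot -big_split/=; apply: eq_bigr => i _; rewrite mxE mulrDl. Qed.

Lemma rV_dotNl x z : rV_dot (- x) z = - rV_dot x z.
Proof. by rewrite /rV_dot -sumrN; apply: eq_bigr => i _; rewrite mxE mulNr. Qed.

(** In the product of the kernels at [x] and [c], the term [sin ((x + c).y)] has integral 0 against
    the centred Gaussian, and [cos ((x - c).y)] leaves a Gaussian in [x - c]. *)
Lemma real_fourier_wave e c x : 0 < e ->
  H (wave e c) x = (Num.sqrt e ^+ n)^-1 * gaussn e^-1 c x.
Proof.
move=> e0; rewrite /real_fourier real_fourier_const.
transitivity ((Num.sqrt (2 * pi) ^+ n)^-1 * \int[mu]_y
   (gaussn e 0 y * cos (rV_dot (x - c) y) - gaussn e 0 y * sin (rV_dot (x + c) y))).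
  congr (_ * _); apply: eq_Rintegral => y _; rewrite /wave /cas (rV_dotC y c).
  by rewrite !rV_dotDl rV_dotNl cosB sinD; ring.
rewrite RintegralB//; last 2 first.
- apply: (integMb (M := 1)) => [||y]; [exact: integ_gaussn| |exact: cos_max].
  apply: measurableT_comp (measurable_rV_dot _).
  by apply: continuous_measurable_fun; exact: continuous_cos.
- apply: (integMb (M := 1)) => [||y]; [exact: integ_gaussn| |exact: sin_max].
  apply: measurableT_comp (measurable_rV_dot _).
  by apply: continuous_measurable_fun; exact: continuous_sin.
have d0 z : rV_dot z 0 = 0 :> R by rewrite /rV_dot big1// => i _; rewrite mxE mulr0.
have [-> _] := integral_gaussn_cos_sin 0 (x - c) e0.
have [_ ->] := integral_gaussn_cos_sin 0 (x + c) e0.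
rewrite !d0 cos0 sin0 mulr0 subr0 mulr1 sqrt2pi_div// exprMn exprVn.
rewrite (_ : gaussn e^-1 0 (x - c) = gaussn e^-1 c x); last first.
  by apply: eq_bigr => i _; rewrite !mxE subr0.
by rewrite !mulrA mulVf ?mul1r// expf_neq0// gt_eqF// sqrt2pi_gt0.
Qed.

Lemma integ_fourier_kernel f y : integ mu f -> integ mu (fun x => f x * cas (rV_dot y x)).
Proof.
move=> fi; apply: (integMb (M := 2)) => // [|x]; last exact: cas_bound.
exact: measurable_cas_dot.
Qed.

Lemma measurable_dot2 : measurable_fun setT (fun z : 'rV[R]_n * 'rV[R]_n => cas (rV_dot z.2 z.1)).
Proof.
apply: measurableT_comp measurable_cas _.
apply: measurable_sum => i; apply: measurable_funM.
  exact: measurableT_comp (measurable_coord i) measurable_snd.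
exact: measurableT_comp (measurable_coord i) measurable_fst.
Qed.

Let integ_double f g : integ mu f -> integ mu g ->
  integ (mu \x mu)%E (fun z => f z.1 * g z.2 * cas (rV_dot z.2 z.1)).
Proof.
move=> fi gi; apply: (integMb (M := 2)) => [||z]; [exact: integ_prodM| |exact: cas_bound].
exact: measurable_dot2.
Qed.

Lemma real_fourier_bound f y : integ mu f ->
  `|H f y| <= (Num.sqrt ((2 * pi) ^+ n))^-1 * (2 * \int[mu]_x `|f x|).
Proof.
move=> fi; rewrite /real_fourier normrM ger0_norm ?invr_ge0 ?sqrtr_ge0//.
rewrite ler_wpM2l ?invr_ge0 ?sqrtr_ge0//.
apply: le_trans (le_normr_Rintegral measurableT (integ_fourier_kernel y fi)) _.
rewrite -RintegralZl//; last exact: integrable_norm.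
apply: le_Rintegral => //.
- by apply: integrable_norm; exact: integ_fourier_kernel.
- by apply: integZl; exact: integrable_norm.
- by move=> x _; rewrite normrM mulrC ler_wpM2r// cas_bound.
Qed.

Let integ_double_l f g y : integ mu f -> integ mu (fun x => f x * g y * cas (rV_dot y x)).
Proof.
move=> fi; have := integZl (g y) (integ_fourier_kernel y fi).
by congr (integrable _ _ _); apply/funext => x /=; congr EFin; ring.
Qed.

Let integ_double_r f g x : integ mu g -> integ mu (fun y => f x * g y * cas (rV_dot y x)).
Proof.
move=> gi; have := integZl (f x) (integ_fourier_kernel x gi).
by congr (integrable _ _ _); apply/funext => y /=; rewrite (rV_dotC y); congr EFin; ring.
Qed.

Let integral_double_l f g y : integ mu f ->
  \int[mu]_x (f x * g y * cas (rV_dot y x)) = g y * \int[mu]_x (f x * cas (rV_dot y x)).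
Proof.
move=> fi; rewrite -RintegralZl//; last exact: integ_fourier_kernel.
by apply: eq_Rintegral => x _; ring.
Qed.

Let integral_double_r f g x : integ mu g ->
  \int[mu]_y (f x * g y * cas (rV_dot y x)) = f x * \int[mu]_y (g y * cas (rV_dot x y)).
Proof.
move=> gi; rewrite -RintegralZl//; last exact: integ_fourier_kernel.
by apply: eq_Rintegral => y _; rewrite (rV_dotC y); ring.
Qed.

Lemma measurable_real_fourier f : integ mu f -> measurable_fun setT (H f).
Proof.
move=> fi; apply: measurable_funM => //.
(* The Gaussian weight in y makes the kernel integrable on the product. *)
pose g := gaussn 1 0; have gi : integ mu g by exact: integ_gaussn.
have g0 y : g y != 0 by rewrite gt_eqF// prodr_gt0// => i _; exact: gauss_gt0.
have := measurable_Rintegral_prod (integ_double gi fi) (fun x => integ_double_r g x fi).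
move=> m.
rewrite (_ : (fun y => _) = fun y => (g y)^-1 * \int[mu]_x (g y * f x * cas (rV_dot x y))); last first.
  by apply/funext => y; rewrite integral_double_r// mulrA mulVf// mul1r.
apply: measurable_funM => //.
have -> : (fun y => (g y)^-1) = fun y => \prod_(i < n) expR (y ord0 i ^+ 2 / 2).
  apply/funext => y; rewrite -prodfV; apply: eq_bigr => i _.
  by rewrite /gauss -expRN opprK mxE subr0 mul1r.
apply: measurable_prod => i _; apply: measurableT_comp => //.
by apply: measurable_funM => //; apply: measurable_funX; exact: measurable_coord.
Qed.

Lemma real_fourier_sym f g : integ mu f -> integ mu g ->
  \int[mu]_x (H f x * g x) = \int[mu]_x (f x * H g x).
Proof.
move=> fi gi; rewrite /real_fourier; set K := _^-1.
have E := @Rfubini _ _ _ _ R mu mu (fun x y => f x * g y * cas (rV_dot y x))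
  (integ_double fi gi) (fun x => integ_double_r f x gi) (fun y => integ_double_l g y fi).
have i1 : integ mu (fun x => H f x * g x).
  under eq_fun do rewrite mulrC.
  by apply: integMb gi (measurable_real_fourier fi) (fun x => real_fourier_bound x fi).
have i2 : integ mu (fun x => f x * H g x).
  by apply: integMb fi (measurable_real_fourier gi) (fun x => real_fourier_bound x gi).
have K0 : K != 0 := invr_neq0 (lt0r_neq0 real_fourier_const_gt0).
apply: (mulfI (invr_neq0 K0)); rewrite -!RintegralZl//.
transitivity (\int[mu]_y \int[mu]_x (f x * g y * cas (rV_dot y x))).
  apply: eq_Rintegral => y _; rewrite integral_double_l//.
  by rewrite -!mulrA mulKf// mulrC.
rewrite -E; apply: eq_Rintegral => x _; rewrite integral_double_r//.
by rewrite mulrCA mulKf.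
Qed.

Lemma integ_real_fourierM f g : integ mu f -> integ mu g -> integ mu (fun x => H f x * g x).
Proof.
move=> fi gi; under eq_fun do rewrite mulrC.
by apply: integMb gi (measurable_real_fourier fi) (fun x => real_fourier_bound x fi).
Qed.

Lemma real_fourierB f g x : integ mu f -> integ mu g ->
  H (fun x => f x - g x) x = H f x - H g x.
Proof.
move=> fi gi; rewrite /real_fourier -mulrBr -RintegralB//; try exact: integ_fourier_kernel.
by congr (_ * _); apply: eq_Rintegral => y _; rewrite mulrBl.
Qed.

Lemma measurable_gaussn2 e : 0 < e ->
  measurable_fun setT (fun z : 'rV[R]_n * 'rV[R]_n => gaussn e z.1 z.2).
Proof.
move=> e0; apply: measurable_prod => i _.
apply: (measurableT_comp (f := gauss e)).
  have := @continuous_gauss R e 0; under eq_fun do rewrite subr0.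
  exact: continuous_measurable_fun.
apply: measurable_funB.
  exact: measurableT_comp (measurable_coord i) measurable_snd.
exact: measurableT_comp (measurable_coord i) measurable_fst.
Qed.

(** Tonelli in the order that integrates the Gaussian first: [gaussnC] exchanges its centre and its
    variable, and its mass does not depend on the centre. *)
Lemma integ_convolution f e : 0 < e -> integ mu f ->
  integ (mu \x mu)%E (fun z => f z.2 * gaussn e z.1 z.2).
Proof.
move=> e0 fi.
have mf : measurable_fun setT (EFin \o (fun z : 'rV[R]_n * 'rV[R]_n => f z.2 * gaussn e z.1 z.2)).
  apply/measurable_EFinP; apply: measurable_funM; last exact: measurable_gaussn2.
  exact: measurableT_comp (integ_measurable fi) measurable_snd.
apply/(integrable21ltyP _ _ mf) => /=.
under eq_integral => y _.
  under eq_integral do rewrite normrM EFinM (ger0_norm (gaussn_ge0 _ _ _)) gaussnC.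
  rewrite ge0_integralZl//; last 2 first.
  - by apply/measurable_EFinP; exact: measurable_gaussn.
  - by move=> x _; rewrite lee_fin gaussn_ge0.
  rewrite -EFin_Rintegral ?integ_gaussn// integral_gaussn//.
  over.
rewrite ge0_integralZr//=; last first.
  by apply/measurable_EFinP; apply: measurableT_comp => //; exact: integ_measurable fi.
have ffin : (\int[mu]_y `|(f y)%:E|)%E \is a fin_num.
  by apply: (integrable_fin_num _ (integrable_norm fi)).
by rewrite -(fineK ffin) -EFinM ltry.
Qed.

End real_fourier_L1.

(** * The contraction bound on L^1 /\ L^2 *)

Section real_fourier_contraction.
Variables (R : realType) (n : nat).
Local Notation mu := (lebesgue_rV R n).
Local Notation H := (@real_fourier R n).
Variable f : 'rV[R]_n -> R.
Hypotheses (fi : integ mu f) (f2 : sqinteg mu f).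

Let f2i : integ mu (fun x => f x ^+ 2). Proof. by case: f2. Qed.

(** Symmetry moves one factor [H f], so that the left-hand side is the pairing of [f] with [H h],
    where [h] is the damped [H f]. The Gaussian averages of [f^2] have the same integral as [f^2],
    hence the two halves of AM-GM add up to the bound. *)
Let damped_bound (e : R) : 0 < e ->
  \int[mu]_y (H f y ^+ 2 * gaussn e 0 y) <= \int[mu]_x f x ^+ 2.
Proof.
move=> e0.
have ei0 : 0 < e^-1 by rewrite invr_gt0.
pose h y := H f y * gaussn e 0 y.
have hi : integ mu h by apply: integ_real_fourierM => //; exact: integ_gaussn.
pose N := Num.sqrt (2 * pi / e^-1) ^+ n : R.
have N0 : 0 < N by rewrite exprn_gt0// sqrtr_gt0 divr_gt0// mulr_gt0// pi_gt0.
have qi x : integ mu (fun z => f z * gaussn e^-1 x z).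
  apply: (integMb (M := 1)) => // [|z]; first exact: measurable_gaussn.
  exact: gaussn_norm_le1.
have q2i x : integ mu (fun z => f z ^+ 2 * gaussn e^-1 x z).
  apply: (integMb (M := 1)) => // [|z]; first exact: measurable_gaussn.
  exact: gaussn_norm_le1.
(* [H h x] is, up to the constant, the pairing of [H f] with [wave e x]; symmetry replaces it by [f]
   against the transform of the wave, a Gaussian. *)
have Hh x : H h x = N^-1 * \int[mu]_z (f z * gaussn e^-1 x z).
  rewrite {1}/real_fourier.
  transitivity ((Num.sqrt ((2 * pi) ^+ n))^-1 * \int[mu]_y (H f y * wave e x y)).
    by congr (_ * _); apply: eq_Rintegral => y _; rewrite /h /wave (rV_dotC x) /cas mulrA.
  rewrite real_fourier_sym//; last exact: integ_wave.
  under eq_Rintegral do rewrite real_fourier_wave// mulrCA.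
  rewrite RintegralZl// mulrA real_fourier_const -invfM -exprMn -sqrtrM ?mulr_ge0 ?pi_ge0//.
  by rewrite /N invrK.
have intq x : \int[mu]_z gaussn e^-1 x z = N by exact: integral_gaussn.
pose C x := \int[mu]_z (f z ^+ 2 * gaussn e^-1 x z).
have conv := integ_convolution ei0 f2i.
have qx z : integ mu (fun x => f z ^+ 2 * gaussn e^-1 x z).
  by under eq_fun do rewrite gaussnC; apply: integZl; exact: integ_gaussn.
have Ci : integ mu C.
  exact: (@integ_Rintegral_prod _ _ _ _ R mu mu (fun x z => f z ^+ 2 * gaussn e^-1 x z)).
have intC : \int[mu]_x C x = N * \int[mu]_x f x ^+ 2.
  rewrite /C (@Rfubini _ _ _ _ R mu mu (fun x z => f z ^+ 2 * gaussn e^-1 x z))//.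
  rewrite -RintegralZl//; apply: eq_Rintegral => z _.
  under eq_Rintegral do rewrite gaussnC.
  by rewrite RintegralZl ?intq 1?mulrC//; exact: integ_gaussn.
have Hhi : integ mu (fun x => f x * H h x).
  apply: (integMb fi (measurable_real_fourier hi)) => x; exact: real_fourier_bound.
(* AM-GM under the Gaussian mean: f(x) f(z) <= (f(x)^2 + f(z)^2) / 2 *)
have step x : f x * H h x <= 2^-1 * f x ^+ 2 + (2 * N)^-1 * C x.
  rewrite Hh mulrCA -RintegralZl//.
  apply: (@le_trans _ _ (N^-1 * \int[mu]_z (2^-1 * f x ^+ 2 * gaussn e^-1 x z +
       2^-1 * (f z ^+ 2 * gaussn e^-1 x z)))).
    rewrite ler_wpM2l ?invr_ge0 ?(ltW N0)//; apply: le_Rintegral => //.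
    - exact: integZl.
    - by apply: integD; apply: integZl => //; exact: integ_gaussn.
    - move=> z _; rewrite [leRHS](_ : _ = 2^-1 * (f x ^+ 2 + f z ^+ 2) * gaussn e^-1 x z); last by ring.
      rewrite mulrA ler_wpM2r ?gaussn_ge0//.
      by have := sqr_ge0 (f x - f z); lra.
  rewrite RintegralD//; last 2 first.
  - by apply: integZl; exact: integ_gaussn.
  - exact: integZl.
  rewrite RintegralZl ?intq//; last exact: integ_gaussn.
  rewrite RintegralZl// -/(C x) le_eqVlt; apply/orP; left; apply/eqP.
  by field; rewrite gt_eqF.
have -> : \int[mu]_y (H f y ^+ 2 * gaussn e 0 y) = \int[mu]_x (f x * H h x).
  rewrite -real_fourier_sym//; apply: eq_Rintegral => y _; rewrite /h; ring.
apply: (@le_trans _ _ (\int[mu]_x (2^-1 * f x ^+ 2 + (2 * N)^-1 * C x))).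
  by apply: le_Rintegral => //; apply: integD; exact: integZl.
rewrite RintegralD//; try exact: integZl.
rewrite !RintegralZl// intC le_eqVlt; apply/orP; left; apply/eqP.
by field; rewrite gt_eqF.
Qed.

Let damped_cvg (y : 'rV[R]_n) : gaussn k.+1%:R^-1 0 y @[k --> \oo] --> (1 : R).
Proof.
pose S : R := (\sum_(i < n) (y ord0 i - (0 : 'rV[R]_n) ord0 i) ^+ 2) / 2.
have h : - (harmonic k * S) @[k --> \oo] --> (- (0 * S) : R).
  by apply: cvgN; apply: cvgM; [exact: cvg_harmonic|exact: cvg_cst].
have := continuous_cvg _ (@continuous_expR R _) h.
rewrite mul0r oppr0 expR0 => hS.
under eq_fun do rewrite gaussnE -mulrA.
exact: hS.
Qed.

Lemma real_fourier_contraction :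
  sqinteg mu (H f) /\ \int[mu]_y H f y ^+ 2 <= \int[mu]_x f x ^+ 2.
Proof.
have mH := measurable_real_fourier fi.
have k0 k : 0 < k.+1%:R^-1 :> R by rewrite invr_gt0.
have [] := @Rfatou_le _ _ R mu (fun k y => H f y ^+ 2 * gaussn k.+1%:R^-1 0 y)
   (fun y => H f y ^+ 2) (\int[mu]_x f x ^+ 2).
- move=> k; under eq_fun do rewrite expr2 -mulrA.
  apply: integ_real_fourierM => //; apply: integ_real_fourierM => //; exact: integ_gaussn.
- exact: measurable_funX.
- by move=> k x; rewrite mulr_ge0 ?sqr_ge0 ?gaussn_ge0.
- by move=> x; exact: sqr_ge0.
- apply: aeW => y; rewrite -[X in _ --> X]mulr1; apply: cvgM; first exact: cvg_cst.
  exact: damped_cvg.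
- by apply: nearW => k; exact: damped_bound.
by move=> ? ?; split.
Qed.

End real_fourier_contraction.

(** * Injectivity on integrable functions *)

Section gauss_indic.
Variable R : realType.
Local Notation leb := (@lebesgue_measure R).

(** For [e > 0], the probability of [A] under the normal law of mean [x] and variance [e^-1]. *)
Definition gauss_mean (e : R) (A : set R) (x : R) : R :=
  (Num.sqrt (2 * pi / e))^-1 * \int[leb]_t (\1_A t * gauss e (t - x)).

Lemma integ_indic_gauss (e : R) (A : set R) x : 0 < e -> measurable A ->
  integ leb (fun t => \1_A t * gauss e (t - x)).
Proof.
move=> e0 mA; under eq_fun do rewrite mulrC.
apply: (integMb (M := 1)) => [||t]; first exact: integ_gauss.
  exact: measurable_indic.
by rewrite indicE; case: (_ \in _); rewrite ?normr1 ?normr0.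
Qed.

(** Only the points with [|t - x| >= d] contribute. There half of the exponent gives a factor at
    most [exp(-e d^2 / 4)], and what remains has precision [e / 2], hence a mass larger by the
    factor [sqrt 2]. At [e = k + 1] the bound is a geometric sequence. *)
Lemma gauss_mean_cvg (A : set R) (x d : R) : measurable A -> 0 < d ->
  (forall t, `|t - x| < d -> (t \in A) = (x \in A)) ->
  gauss_mean k.+1%:R A x @[k --> \oo] --> (\1_A x : R).
Proof.
move=> mA d0 Ad.
have bnd (e : R) : 0 < e ->
    `|gauss_mean e A x - \1_A x| <= Num.sqrt 2 * expR (- (e * (d ^+ 2 / 4))).
  move=> e0; rewrite /gauss_mean.
  have e20 : 0 < e / 2 by rewrite divr_gt0.
  set N := Num.sqrt _; have N0 : 0 < N by rewrite sqrtr_gt0 divr_gt0// mulr_gt0// pi_gt0.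
  have -> : \1_A x = N^-1 * \int[leb]_t (\1_A x * gauss e (t - x)) :> R.
    rewrite RintegralZl//; last exact: integ_gauss.
    by rewrite integral_gauss// mulrCA mulVf ?mulr1// gt_eqF.
  have i1 := integ_indic_gauss x e0 mA.
  have i2 : integ leb (fun t => \1_A x * gauss e (t - x)).
    by apply: integZl; exact: integ_gauss.
  rewrite -mulrBr -RintegralB// normrM ger0_norm ?invr_ge0 ?(ltW N0)//.
  rewrite ler_pdivrMl//.
  have i3 := integB i1 i2.
  apply: le_trans (le_normr_Rintegral measurableT i3) _.
  apply: (@le_trans _ _ (\int[leb]_t (expR (- (e * (d ^+ 2 / 4))) * gauss (e / 2) (t - x)))).
    apply: le_Rintegral => //.
    - exact: integrable_norm.
    - by apply: integZl; exact: integ_gauss.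
    move=> t _; rewrite -mulrBl normrM [X in _ * X]ger0_norm ?expR_ge0//.
    have [td|td] := ltP (`|t - x|) d.
      by rewrite !indicE Ad// subrr normr0 mul0r mulr_ge0 ?expR_ge0.
    apply: (@le_trans _ _ (1 * gauss e (t - x))).
      rewrite ler_wpM2r ?expR_ge0// !indicE.
      by case: (t \in A); case: (x \in A); rewrite ?subrr ?subr0 ?sub0r ?normrN ?normr1 ?normr0.
    rewrite mul1r /gauss -expRD ler_expR.
    have : d ^+ 2 <= (t - x) ^+ 2.
      by rewrite -[leRHS]real_normK ?num_real// lerXn2r ?nnegrE ?(ltW d0).
    by move=> dt; have := ler_wpM2l (ltW e0) dt; lra.
  rewrite RintegralZl//; last exact: integ_gauss.
  rewrite integral_gauss// le_eqVlt; apply/orP; left; apply/eqP.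
  have -> : 2 * pi / (e / 2) = (2 * pi / e) * 2 :> R by field; rewrite gt_eqF.
  by rewrite sqrtrM ?divr_ge0 ?mulr_ge0 ?pi_ge0 ?(ltW e0)// -/N; ring.
apply/subr_cvg0; apply: norm_cvg0.
have h : Num.sqrt 2 * expR (- (d ^+ 2 / 4)) ^+ k.+1 @[k --> \oo] --> (0 : R).
  rewrite -(mulr0 (Num.sqrt 2)); apply: cvgMr.
  rewrite (cvg_shiftS (fun k => expR (- (d ^+ 2 / 4)) ^+ k)).
  apply: cvg_expr; rewrite ger0_norm ?expR_ge0// expR_lt1 oppr_lt0.
  by rewrite divr_gt0// exprn_gt0.
apply: (squeeze_cvgr _ (@cvg_cst _ (0 : R) _ _ _) h); near=> k.
rewrite normr_ge0/= -expRM_natl mulrN; exact: bnd.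
Unshelve. all: by end_near. Qed.

End gauss_indic.

Section real_fourier_injective.
Variables (R : realType) (n : nat).
Local Notation leb := (@lebesgue_measure R).
Local Notation mu := (lebesgue_rV R n).
Local Notation H := (@real_fourier R n).
Lemma Rintegral_rV_prod (g : 'I_n -> R -> R) : (forall i, integ leb (g i)) ->
  \int[mu]_v (\prod_(i < n) g i (v ord0 i)) = \prod_(i < n) \int[leb]_t g i t.
Proof.
move=> gi.
have hc i : \int[leb]_t (g i t * cos ((0 : 'rV[R]_n) ord0 i * t)) = \int[leb]_t g i t * cos 0.
  by rewrite cos0 mulr1; apply: eq_Rintegral => t _; rewrite mxE mul0r cos0 mulr1.
have hs i : \int[leb]_t (g i t * sin ((0 : 'rV[R]_n) ord0 i * t)) = \int[leb]_t g i t * sin 0.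
  rewrite sin0 mulr0; under eq_Rintegral do rewrite mxE mul0r sin0 mulr0.
  by rewrite Rintegral_cst// mul0r.
have [{}hc _] := Rintegral_rV_cos_sin gi hc hs.
move: hc; rewrite [X in _ * cos X]big1// cos0 mulr1 => <-; apply: eq_Rintegral => v _.
by rewrite /rV_dot [X in cos X]big1 ?cos0 ?mulr1// => i _; rewrite mxE mul0r.
Qed.

(* None stands for the whole line: orthants then form a pi-system containing setT. *)
Definition upray (o : option R) : set R := if o is Some a then `]a, +oo[%classic else setT.

Lemma measurable_upray o : measurable (upray o).
Proof. by case: o => [a|] //=. Qed.

Definition orthant (o : 'I_n -> option R) : set 'rV[R]_n :=
  [set x | forall i, upray (o i) (x ord0 i)].

Lemma measurable_orthant o : measurable (orthant o).
Proof.
rewrite (_ : orthant o = \bigcap_(i in [set: 'I_n]) ((fun x : 'rV[R]_n => x ord0 i)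
    @^-1` upray (o i))); last first.
  by apply/seteqP; split=> x /= Ax i; [move=> _; exact: Ax|exact: Ax].
apply: fin_bigcap_measurable => // i _.
rewrite -[X in measurable X]setTI; apply: measurable_coord => //.
exact: measurable_upray.
Qed.

Lemma indic_orthant o x : \1_(orthant o) x = \prod_(i < n) \1_(upray (o i)) (x ord0 i) :> R.
Proof.
rewrite indicE; have [/set_mem xo|xo] := boolP (x \in orthant o).
  by rewrite big1// => i _; rewrite indicE mem_set.
have [i xi] : exists i, ~ upray (o i) (x ord0 i).
  by apply/existsNP => xo'; move/negP: xo; apply; rewrite inE.
by rewrite (bigD1 i)//= indicE memNset// mul0r.
Qed.

(** The Gaussian mean of a ray is 1/2 at its endpoint, so the hyperplanes through the endpoints have
    to be removed. Each of them is a box with one side of measure 0. *)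
Let ae_coord_neq (a : 'I_n -> option R) :
  {ae mu, forall x : 'rV[R]_n, forall i, Some (x ord0 i) != a i}.
Proof.
apply: filter_forall => i; case: (a i) => [b|]; last exact: aeW.
pose A j : set R := if j == i then [set b] else setT.
have mA j : measurable (A j) by rewrite /A; case: ifP.
exists [set x : 'rV[R]_n | forall j, A j (x ord0 j)]; split.
- rewrite (_ : mkset _ = \bigcap_(j in [set: 'I_n]) ((fun x : 'rV[R]_n => x ord0 j) @^-1` A j)).
    apply: fin_bigcap_measurable => // j _.
    by rewrite -[X in measurable X]setTI; apply: measurable_coord.
  by apply/seteqP; split=> x /= Ax j; [move=> _; exact: Ax|exact: Ax].
- have := lebesgue_rV_box mA => ->.
  by rewrite (bigD1 i)//= /A eqxx lebesgue_measure_set1 mul0e.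
- move=> x /= /negP; rewrite negbK => /eqP[xb] j.
  by rewrite /A; case: eqP => // ->.
Qed.

Let cvg_prod (I : Type) (s : seq I) (u : I -> nat -> R) (l : I -> R) :
  (forall i, u i k @[k --> \oo] --> l i) ->
  \prod_(i <- s) u i k @[k --> \oo] --> \prod_(i <- s) l i.
Proof.
move=> ul; elim: s => [|i s IH].
  by under eq_fun do rewrite big_nil; rewrite big_nil; exact: cvg_cst.
by under eq_fun do rewrite big_cons; rewrite big_cons; exact: cvgM.
Qed.

Let mean_cvg o : {ae mu, forall x : 'rV[R]_n,
  \prod_(i < n) gauss_mean k.+1%:R (upray (o i)) (x ord0 i)
   @[k --> \oo] --> (\1_(orthant o) x : R)}.
Proof.
apply: filterS (ae_coord_neq o) => x xo; rewrite indic_orthant.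
apply: cvg_prod => i; move: (xo i); case: (o i) => [a|] /= xa.
  (* Within this distance of [x ord0 i] one stays on the same side of [a]. *)
  apply: (@gauss_mean_cvg _ _ _ `|x ord0 i - a|) => //.
    by rewrite normr_gt0 subr_eq0; apply: contra xa => /eqP ->.
  move=> t tx; apply/idP/idP => /set_mem /=; rewrite in_itv/= andbT => h;
    apply/mem_set; rewrite /= in_itv/= andbT.
    have {}xa : x ord0 i != a by apply: contra xa => /eqP ->.
    rewrite ltNge; apply/negP => xa'.
    move: tx; rewrite (ler0_norm (x := x ord0 i - a)) ?subr_le0// opprB ger0_norm ?subr_ge0.
      by rewrite ltrD2r => ta; move: (lt_trans h ta); rewrite ltxx.
    exact: le_trans xa' (ltW h).
  rewrite ltNge; apply/negP => ta.
  move: tx; rewrite (ger0_norm (x := x ord0 i - a)) ?subr_ge0 ?(ltW h)//.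
  rewrite distrC ger0_norm ?subr_ge0; last exact: le_trans ta (ltW h).
  by rewrite ltrD2l ltrN2 ltNge ta.
by apply: (@gauss_mean_cvg _ _ _ 1) => // t _; rewrite !in_setT.
Qed.

Let mean_le1 (e : R) A t : 0 < e -> measurable A -> `|gauss_mean e A t| <= 1.
Proof.
move=> e0 mA; rewrite /gauss_mean.
set N := Num.sqrt _; have N0 : 0 < N by rewrite sqrtr_gt0 divr_gt0// mulr_gt0// pi_gt0.
rewrite normrM ger0_norm ?invr_ge0 ?(ltW N0)// ler_pdivrMl// mulr1.
have i1 := integ_indic_gauss t e0 mA.
apply: le_trans (le_normr_Rintegral measurableT i1) _.
rewrite /N -(integral_gauss e0 t); apply: le_Rintegral => //.
- exact: integrable_norm.
- exact: integ_gauss.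
move=> x _; rewrite normrM [X in _ * X]ger0_norm ?expR_ge0// -[leRHS]mul1r.
by rewrite ler_wpM2r ?expR_ge0// indicE; case: (_ \in _); rewrite ?normr1 ?normr0.
Qed.

Let meanE (e : R) o (x : 'rV[R]_n) : 0 < e ->
  \prod_(i < n) gauss_mean e (upray (o i)) (x ord0 i) =
  (Num.sqrt (2 * pi / e) ^+ n)^-1 * \int[mu]_c (\1_(orthant o) c * gaussn e x c).
Proof.
move=> e0; rewrite big_split/= prodr_const card_ord exprVn; congr (_ * _).
rewrite -(@Rintegral_rV_prod (fun i t => \1_(upray (o i)) t * gauss e (t - x ord0 i))).
  by apply: eq_Rintegral => c _; rewrite big_split/= indic_orthant.
by move=> i; apply: integ_indic_gauss => //; exact: measurable_upray.
Qed.

Let m1 o : measurable_fun setT (\1_(orthant o) : 'rV[R]_n -> R).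
Proof. by apply: measurable_indic; exact: measurable_orthant. Qed.

Let le1 (A : set 'rV[R]_n) x : `|\1_A x| <= 1 :> R.
Proof. by rewrite indicE; case: (_ \in _); rewrite ?normr1 ?normr0. Qed.

(** A ray in coordinate [i] is the orthant with [None] elsewhere, and rays generate the Borel sets
    of the line. *)
Lemma measurable_orthantE : @measurable _ 'rV[R]_n = <<s range orthant >>.
Proof.
apply/seteqP; split; last first.
  apply: smallest_sub; first exact: sigma_algebra_measurable.
  by move=> _ [u _ <-]; exact: measurable_orthant.
apply: smallest_sub; first exact: smallest_sigma_algebra.
move=> A; rewrite -bigcup_seq/= => -[i _ [B mB <-]].
suff : (@measurable_fun _ _ (g_sigma_algebraType (range orthant)) R setT
    (fun x : g_sigma_algebraType (range orthant) => (x : 'rV[R]_n) ord0 i)).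
  by move=> /(_ measurableT B mB).
apply: (measurability _ (RGenOInfty.measurableE R)) => // _ [_ [a ->] <-].
rewrite setTI; apply: sub_gen_smallest.
exists (fun j => if j == i then Some a else None) => //.
apply/seteqP; split=> x /=; first by move=> /(_ i); rewrite eqxx.
by move=> xa j; case: eqP => [->|].
Qed.

Lemma setI_closed_orthant : setI_closed (range orthant).
Proof.
move=> _ _ [a _ <-] [b _ <-].
exists (fun i => if a i is Some s
  then Some (if b i is Some t then Num.max s t else s) else b i) => //.
apply/seteqP; split=> x /=.
  move=> xab; split=> i; have := xab i; rewrite /upray;
    case: (a i) => [s|]; case: (b i) => [t|] //=; rewrite !in_itv/= !andbT ?gt_max//.
    by move=> /andP[].
  by move=> /andP[].
move=> [xa xb] i; have := xa i; have := xb i; rewrite /upray.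
by case: (a i) => [s|]; case: (b i) => [t|] //=; rewrite !in_itv/= !andbT gt_max => -> ->.
Qed.

Variable f : 'rV[R]_n -> R.
Hypothesis fi : integ mu f.
Hypothesis Hf0 : forall y, H f y = 0.

(** [gaussn e c] is a multiple of the transform of [wave e^-1 c]; symmetry puts the transform on
    [f], where it is 0. *)
Let orth_gaussn (e : R) c : 0 < e -> \int[mu]_z (f z * gaussn e c z) = 0.
Proof.
move=> e0; have ei0 : 0 < e^-1 by rewrite invr_gt0.
have := real_fourier_sym fi (integ_wave c ei0).
under eq_Rintegral do rewrite Hf0 mul0r.
rewrite Rintegral_cst// mul0r.
under eq_Rintegral do rewrite real_fourier_wave// invrK mulrCA.
rewrite RintegralZl; first last.
- apply: (integMb (M := 1)) => // [|z]; first exact: measurable_gaussn.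
  exact: gaussn_norm_le1.
- by [].
move/esym/eqP; rewrite mulf_eq0 => /orP[|/eqP//].
by rewrite invr_eq0 expf_eq0 gt_eqF ?andbF// sqrtr_gt0.
Qed.

(** [F k] is [f] times the Gaussian mean of the indicator. Fubini moves the averaging onto [f],
    where [orth_gaussn] annihilates it, and dominated convergence with majorant [|f|] replaces the
    mean by the indicator. *)
Lemma integral_orthant_eq0 o : \int[mu]_x (f x * \1_(orthant o) x) = 0.
Proof.
pose F k (x : 'rV[R]_n) := f x * \prod_(i < n) gauss_mean k.+1%:R (upray (o i)) (x ord0 i).
have FE k x : F k x = (Num.sqrt (2 * pi / k.+1%:R) ^+ n)^-1 *
    \int[mu]_c (f x * gaussn k.+1%:R x c * \1_(orthant o) c).
  rewrite /F meanE// mulrCA; congr (_ * _); rewrite -RintegralZl//.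
    by apply: eq_Rintegral => c _; ring.
  under eq_fun do rewrite mulrC.
  by apply: (integMb (M := 1)) => //; exact: integ_gaussn.
have ri k x : integ mu (fun c => f x * gaussn k.+1%:R x c * \1_(orthant o) c).
  apply: (integMb (M := 1)) => //.
  by apply: integZl; exact: integ_gaussn.
have li k c : integ mu (fun x => f x * gaussn k.+1%:R x c * \1_(orthant o) c).
  apply: (integMb (M := 1)) => //.
  apply: (integMb (M := 1)) => //.
    by under eq_fun do rewrite gaussnC; exact: measurable_gaussn.
  by move=> x; exact: gaussn_norm_le1.
have di k : integ (mu \x mu)%E (fun z => f z.1 * gaussn k.+1%:R z.1 z.2 * \1_(orthant o) z.2).
  apply: (integMb (M := 1)) => //; last exact: measurableT_comp (m1 o) measurable_snd.
  apply: (@integ_swap _ _ _ _ R mu mu (fun c x => f x * gaussn k.+1%:R x c)).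
  have := @integ_convolution R n f k.+1%:R (ltr0Sn _ _) fi.
  by congr (integrable _ _ _); apply/funext => z /=; rewrite gaussnC.
have iF k : integ mu (F k).
  have := integZl ((Num.sqrt (2 * pi / k.+1%:R) ^+ n)^-1) (integ_Rintegral_prod (di k) (ri k)).
  by congr (integrable _ _ _); apply/funext => x /=; rewrite FE.
have F0 k : \int[mu]_x F k x = 0.
  under eq_Rintegral do rewrite FE.
  rewrite RintegralZl//; last exact: (integ_Rintegral_prod (di k) (ri k)).
  rewrite (Rfubini (di k) (ri k) (li k)).
  rewrite (_ : (fun c => _) = cst 0) ?Rintegral_cst ?mul0r ?mulr0//.
  apply/funext => c /=.
  transitivity (\int[mu]_x (\1_(orthant o) c * (f x * gaussn k.+1%:R c x))).
    by apply: eq_Rintegral => x _; rewrite gaussnC mulrC.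
  rewrite RintegralZl ?orth_gaussn ?mulr0//.
  apply: (integMb (M := 1)) => //; first exact: measurable_gaussn.
  by move=> x; exact: gaussn_norm_le1.
have h : \int[mu]_x F k x @[k --> \oo] --> \int[mu]_x (f x * \1_(orthant o) x).
  apply: (@Rdominated_cvg _ _ R mu F _ (Num.norm \o f)).
  - by move=> k; exact: integ_measurable (iF k).
  - by apply: measurable_funM => //; exact: integ_measurable fi.
  - apply: filterS (mean_cvg o) => x hx; apply: cvgM => //; exact: cvg_cst.
  - exact: integrable_norm.
  - move=> k x; rewrite /F normrM -[leRHS]mulr1 ler_wpM2l// normr_prod.
    rewrite prodr_ile1// => i _; rewrite normr_ge0/= mean_le1//; exact: measurable_upray.
rewrite -(cvg_lim _ h)//; under eq_fun do rewrite F0.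
by rewrite lim_cst.
Qed.

(** Dynkin's theorem: orthants form a generating pi-system, and sets of null integral are stable
    under complements and countable disjoint unions. [orthant (fun=> None)] supplies the null
    integral over the whole space that complements require. *)
Lemma real_fourier_eq0 : f = cst 0 %[ae mu].
Proof.
have PT (A : set 'rV[R]_n) : measurable A ->
    (\int[mu]_(x in A) (f x)%:E = (\int[mu]_x (f x * \1_A x))%:E)%E.
  move=> mA; rewrite EFin_Rintegral; last first.
    by apply: (integMb (M := 1)) => //; exact: measurable_indic.
  rewrite [LHS]integral_mkcond; apply: eq_integral => x _.
  by rewrite restrict_EFin /= patch_indic.
have key A : measurable A -> (\int[mu]_(x in A) (f x)%:E = 0)%E.
  rewrite measurable_orthantE.
  apply: (@dynkin_induction _ _ _ (fun A => (\int[mu]_(x in A) (f x)%:E = 0)%E)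
    measurable_orthantE setI_closed_orthant).
  - rewrite (_ : setT = orthant (fun=> None)).
      by rewrite PT ?integral_orthant_eq0//; exact: measurable_orthant.
    by apply/esym/seteqP; split.
  - by move=> _ [u _ <-]; rewrite PT ?integral_orthant_eq0//; exact: measurable_orthant.
  - move=> S mS S0.
    have : (\int[mu]_(x in setT) (f x)%:E = 0)%E.
      rewrite (_ : setT = orthant (fun=> None)).
        by rewrite PT ?integral_orthant_eq0//; exact: measurable_orthant.
      by apply/esym/seteqP; split.
    rewrite -(setUv S) integral_setU//.
    + by rewrite S0 add0e.
    + exact: measurableC.
    + by rewrite setUv; exact: measurable_int fi.
    + by apply/disj_setPS; rewrite setICr.
  - move=> F mF tF F0; rewrite integral_bigcup//.
      by rewrite eseries0.
    apply: integrableS fi => //; exact: bigcup_measurable.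
have : ae_eq mu setT (EFin \o f) (cst 0%E).
  by apply: integral_ae_eq => // E _ mE; rewrite integral0 key.
by apply: filterS => x h _; have [] := h I.
Qed.

End real_fourier_injective.

(** * Extension to square integrable functions *)

Section L2cvg.
Context d (T : measurableType d) (R : realType).
Variable mu : {measure set T -> \bar R}.
Implicit Types a b : T -> R.

Definition L2cvg (a_ : nat -> T -> R) a := forall e : R, 0 < e ->
  exists N, forall k, (N <= k)%N -> \int[mu]_x (a_ k x - a x) ^+ 2 <= e.

Lemma L2cvg_mul (a_ : nat -> T -> R) a b : (forall k, sqinteg mu (a_ k)) -> sqinteg mu a ->
  sqinteg mu b -> L2cvg a_ a ->
  \int[mu]_x (a_ k x * b x) @[k --> \oo] --> \int[mu]_x (a x * b x).
Proof.
move=> ha_ ha hb aa; apply/cvgrPdist_le => e e0.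
set B := \int[mu]_x b x ^+ 2.
have B0 : 0 <= B by apply: Rintegral_ge0 => x _; exact: sqr_ge0.
have B10 : 0 < B + 1 by rewrite ltr_wpDl.
(* With this tolerance and the weight [(B + 1) / e] in [integral_mul_le], both terms are at most
   [e]; the [+ 1] covers [B = 0]. *)
have [N HN] := aa (e ^+ 2 / (B + 1)) (divr_gt0 (exprn_gt0 2 e0) B10).
exists N => // k /= /HN aN.
have hd := sqintegB (ha_ k) ha.
have t0 : 0 < (B + 1) / e by rewrite divr_gt0.
have := integral_mul_le t0 hd hb.
have -> : \int[mu]_x ((a_ k x - a x) * b x) = \int[mu]_x (a_ k x * b x) - \int[mu]_x (a x * b x).
  rewrite -RintegralB//; try exact: sqinteg_mul.
  by apply: eq_Rintegral => x _; rewrite mulrBl.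
rewrite distrC -/B => h.
rewrite -(ler_pM2l (x := 2))//; apply: le_trans h _.
rewrite mulr_natl mulr2n lerD//.
  have := ler_wpM2l (ltW t0) aN => /le_trans; apply; rewrite le_eqVlt; apply/orP; left; apply/eqP.
  by field; rewrite !gt_eqF.
by rewrite invf_div mulrAC ler_pdivrMr// ler_wpM2l ?(ltW e0)// lerDl.
Qed.

End L2cvg.

Section truncation.
Variables (R : realType) (n : nat).
Local Notation mu := (lebesgue_rV R n).
Implicit Types u : 'rV[R]_n -> R.

Definition box (k : nat) : set 'rV[R]_n := [set x | forall i, `[- k%:R, k%:R]%classic (x ord0 i)].

(** A box has finite measure, so this cut-off brings L^2 functions into L^1 /\ L^2, where the
    contraction bound applies. *)
Definition trunc k u x := u x * \1_(box k) x.

Lemma measurable_box k : measurable (box k).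
Proof.
rewrite (_ : box k = \bigcap_(j in [set: 'I_n])
  ((fun x : 'rV[R]_n => x ord0 j) @^-1` `[- k%:R, k%:R]%classic)).
  apply: fin_bigcap_measurable => // j _.
  by rewrite -[X in measurable X]setTI; apply: measurable_coord.
by apply/seteqP; split=> x /= Ax j; [move=> _; exact: Ax|exact: Ax].
Qed.

Lemma box_finite k : (mu (box k) < +oo)%E.
Proof.
rewrite (@lebesgue_rV_box R n (fun=> `[- k%:R, k%:R]%classic))//.
under eq_bigr do rewrite lebesgue_measure_itv/= lte_fin.
(* The sides degenerate for [k = 0]: the product is then 0, or 1 if it is empty. *)
case: ifP => _; last first.
  by case: n => [|m]; rewrite ?big_ord0 ?ltry// big_ord_recl mul0e.
by rewrite -EFinD prodEFin ltry.
Qed.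

Lemma sqinteg_box k : sqinteg mu (\1_(box k)).
Proof.
split; first exact: measurable_indic (measurable_box k).
rewrite (_ : (fun x => _) = \1_(box k)); last first.
  by apply/funext => x; rewrite indicE; case: (_ \in _); rewrite ?expr1n ?expr0n.
apply/integrableP; split; first by apply/measurable_EFinP; exact: measurable_indic (measurable_box k).
under eq_integral do rewrite /= ger0_norm//.
by rewrite integral_indic ?setIT ?box_finite//; exact: measurable_box.
Qed.

Lemma integ_trunc k u : sqinteg mu u -> integ mu (trunc k u).
Proof. by move=> hu; apply: sqinteg_mul => //; exact: sqinteg_box. Qed.

Let indic_le1 k x : `|\1_(box k) x| <= 1 :> R.
Proof. by rewrite indicE; case: (_ \in _); rewrite ?normr1 ?normr0. Qed.

Lemma sqinteg_trunc k u : sqinteg mu u -> sqinteg mu (trunc k u).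
Proof.
move=> hu; apply: (sqintegMb (M := 1)) => //.
exact: measurable_indic (measurable_box k).
Qed.

Lemma trunc_cvg u x : trunc k u x @[k --> \oo] --> u x.
Proof.
apply: (cvg_near_cst (u x)).
near=> k; rewrite /trunc indicE mem_set ?mulr1// => i.
rewrite /= in_itv/= -ler_norml.
(* The sum bounds all coordinates at once, so that one threshold in [k] serves every [i]. *)
apply: (@le_trans _ _ (\sum_(j < n) `|x ord0 j|)).
  by rewrite (bigD1 i)//= lerDl sumr_ge0.
near: k; exact: nbhs_infty_ger.
Unshelve. all: by end_near. Qed.

Lemma trunc_L2cvg u : sqinteg mu u -> L2cvg mu (trunc ^~ u) u.
Proof.
move=> hu e e0.
have h : \int[mu]_x (trunc k u x - u x) ^+ 2 @[k --> \oo] --> \int[mu]_x (0 : R).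
  apply: (@Rdominated_cvg _ _ R mu (fun k x => (trunc k u x - u x) ^+ 2)
    (fun=> 0) (fun x => u x ^+ 2)) => //.
  - move=> k; apply: measurable_funX; apply: measurable_funB; last by case: hu.
    by case: (sqinteg_trunc k hu).
  - apply: aeW => x; have := @trunc_cvg u x => /subr_cvg0 h.
    by rewrite -(mulr0 (0 : R)); apply: cvgM.
  - by case: hu.
  - move=> k x; rewrite normrX -[leRHS]real_normK ?num_real// lerXn2r ?nnegrE//.
    rewrite /trunc indicE; case: (_ \in _); first by rewrite mulr1 subrr normr0.
    by rewrite mulr0 sub0r normrN.
rewrite Rintegral_cst// mul0r in h.
have /cvgrPdist_le/(_ _ e0)[N _ HN] := h; exists N => k /HN.
by rewrite sub0r normrN; apply: le_trans; exact: ler_norm.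
Qed.

(** The truncations of [w1 - w2] are themselves admissible tests; their pairings with [w1 - w2] are
    0 and tend to the integral of [(w1 - w2)^2]. *)
Lemma sqinteg_sep (w1 w2 : 'rV[R]_n -> R) : sqinteg mu w1 -> sqinteg mu w2 ->
  (forall g, integ mu g -> sqinteg mu g ->
    \int[mu]_x (w1 x * g x) = \int[mu]_x (w2 x * g x)) ->
  w1 = w2 %[ae mu].
Proof.
move=> h1 h2 w12; have hd := sqintegB h1 h2.
have h0 k : \int[mu]_x (trunc k (fun x => w1 x - w2 x) x * (w1 x - w2 x)) = 0.
  have gi := integ_trunc k hd; have g2 := sqinteg_trunc k hd.
  under eq_Rintegral do rewrite mulrC mulrBl.
  rewrite RintegralB//; try exact: sqinteg_mul.
  by rewrite w12// subrr.
have := L2cvg_mul (fun k => sqinteg_trunc k hd) hd hd (trunc_L2cvg hd).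
under eq_fun do rewrite h0.
move/cvg_lim => /(_ (@norm_hausdorff _ R)); rewrite lim_cst// => h.
have := integral_sqr_eq0 hd.
rewrite (_ : \int[mu]_x (w1 x - w2 x) ^+ 2 = 0) ?lexx; last first.
  transitivity (\int[mu]_x ((w1 x - w2 x) * (w1 x - w2 x))); last exact: esym h.
  by apply: eq_Rintegral => x _; rewrite expr2.
move=> /(_ isT); apply: filterS => x /= + _ => /(_ I) /eqP; rewrite subr_eq0 => /eqP.
exact.
Qed.

End truncation.

Section extension.
Variables (R : realType) (n : nat).
Local Notation mu := (lebesgue_rV R n).
Local Notation H := (@real_fourier R n).
Implicit Types u v g w : 'rV[R]_n -> R.

(* The pairing with L^1 /\ L^2 determines w up to a null set; the convergence of the
   truncations is what self-adjointness on all of L^2 rests on. *)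
Definition extension_of u w := [/\ sqinteg mu w, L2cvg mu (fun k => H (trunc k u)) w &
  forall g, integ mu g -> sqinteg mu g -> \int[mu]_x (w x * g x) = \int[mu]_x (u x * H g x)].

Let sqr_sub_le (a b c : 'rV[R]_n -> R) : sqinteg mu a -> sqinteg mu b -> sqinteg mu c ->
  \int[mu]_x (a x - b x) ^+ 2 <=
  2 * \int[mu]_x (a x - c x) ^+ 2 + 2 * \int[mu]_x (b x - c x) ^+ 2.
Proof.
move=> ha hb hc; have [_ i1] := sqintegB ha hc; have [_ i2] := sqintegB hb hc.
have [_ i3] := sqintegB ha hb.
rewrite -!RintegralZl// -RintegralD//; try exact: integZl.
apply: le_Rintegral => //; first by apply: integD; exact: integZl.
move=> x _; have := sqr_ge0 ((a x - c x) + (b x - c x)); lra.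
Qed.

(** The contraction bound on differences makes the transformed truncations Cauchy; the symmetry of
    [H] then passes to the limit on both sides of the pairing. *)
Lemma extension_exists u : sqinteg mu u -> exists w, extension_of u w.
Proof.
move=> hu.
have hH k : sqinteg mu (H (trunc k u)).
  by have [] := real_fourier_contraction (integ_trunc k hu) (sqinteg_trunc k hu).
have [e e0|w hw Hw] := L2_complete hH.
  (* The tolerance is [e / 4], since [sqr_sub_le] doubles each of two such terms. *)
  have [N HN] := trunc_L2cvg hu (divr_gt0 e0 (ltr0Sn _ 3)).
  exists N => k l Nk Nl.
  have hkl := sqintegB (sqinteg_trunc k hu) (sqinteg_trunc l hu).
  have ikl := integB (integ_trunc k hu) (integ_trunc l hu).
  have [_] := real_fourier_contraction ikl hkl.
  under eq_Rintegral do rewrite (real_fourierB _ (integ_trunc k hu) (integ_trunc l hu)).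
  move/le_trans; apply.
  apply: le_trans (sqr_sub_le (sqinteg_trunc k hu) (sqinteg_trunc l hu) hu) _.
  by have := HN k Nk; have := HN l Nl; lra.
exists w; split=> // g gi g2.
have hHg : sqinteg mu (H g) by have [] := real_fourier_contraction gi g2.
have h1 := L2cvg_mul hH hw g2 Hw.
have h2 := L2cvg_mul (fun k => sqinteg_trunc k hu) hu hHg (trunc_L2cvg hu).
have E k := real_fourier_sym (integ_trunc k hu) gi.
rewrite (funext E) in h1.
exact: (cvg_unique _ h1 h2).
Qed.

Lemma extension_L1 u w : integ mu u -> sqinteg mu u -> extension_of u w -> w = H u %[ae mu].
Proof.
move=> ui u2 [hw _ E]; apply: sqinteg_sep => //.
  by have [] := real_fourier_contraction ui u2.
by move=> g gi g2; rewrite E// real_fourier_sym.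
Qed.

Lemma extension_linear a u v wu wv w : sqinteg mu u -> sqinteg mu v ->
  extension_of u wu -> extension_of v wv ->
  extension_of (fun x => a * u x + v x) w -> w = (fun x => a * wu x + wv x) %[ae mu].
Proof.
move=> hu hv [h1 _ E1] [h2 _ E2] [h _ E]; apply: sqinteg_sep => //.
  by apply: sqintegD => //; exact: sqintegZ.
move=> g gi g2; have [hHg _] := real_fourier_contraction gi g2.
have S (p q r : 'rV[R]_n -> R) : sqinteg mu p -> sqinteg mu q -> sqinteg mu r ->
    \int[mu]_x ((a * p x + q x) * r x) = a * \int[mu]_x (p x * r x) + \int[mu]_x (q x * r x).
  move=> hp hq hr; have i1 := sqinteg_mul hp hr; have i2 := sqinteg_mul hq hr.
  rewrite -RintegralZl// -RintegralD//; last exact: integZl.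
  by apply: eq_Rintegral => x _; rewrite mulrDl mulrA.
by rewrite E// !S// E1// E2.
Qed.

(** The pairing clause for [wu] takes integrable test functions only, so it is applied to the
    truncations of [v]; the convergence clause for [wv] gives the limit of their transforms. *)
Lemma extension_sym u v wu wv : sqinteg mu u -> sqinteg mu v ->
  extension_of u wu -> extension_of v wv ->
  \int[mu]_x (wu x * v x) = \int[mu]_x (u x * wv x).
Proof.
move=> hu hv [h1 _ E1] [h2 c2 _].
have hH k : sqinteg mu (H (trunc k v)).
  by have [] := real_fourier_contraction (integ_trunc k hv) (sqinteg_trunc k hv).
have l1 := L2cvg_mul (fun k => sqinteg_trunc k hv) hv h1 (trunc_L2cvg hv).
have l2 := L2cvg_mul hH h2 hu c2.
have E k : \int[mu]_x (trunc k v x * wu x) = \int[mu]_x (H (trunc k v) x * u x).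
  under eq_Rintegral do rewrite mulrC.
  rewrite E1; [|exact: integ_trunc|exact: sqinteg_trunc].
  by apply: eq_Rintegral => x _; rewrite mulrC.
have {l1}l1 : \int[mu]_x (H (trunc k v) x * u x) @[k --> \oo] --> \int[mu]_x (v x * wu x).
  by rewrite -(funext E).
under eq_Rintegral do rewrite mulrC.
rewrite (cvg_unique _ l1 l2)//; by apply: eq_Rintegral => x _; rewrite mulrC.
Qed.

Lemma sqinteg_gaussn c : sqinteg mu (gaussn 1 c).
Proof.
split; first exact: measurable_gaussn.
under eq_fun do rewrite expr2.
apply: (integMb (M := 1)); [exact: integ_gaussn|exact: measurable_gaussn|].
by move=> x; exact: gaussn_norm_le1.
Qed.

Lemma sqinteg_wave c : sqinteg mu (wave 1 c).
Proof.
apply: (sqintegMb (M := 2)); first exact: sqinteg_gaussn.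
  by under eq_fun do rewrite rV_dotC; exact: measurable_cas_dot.
by move=> x; exact: cas_bound.
Qed.

Lemma real_fourier_wave1 c : H (wave 1 c) = gaussn 1 c.
Proof.
apply/funext => x; rewrite real_fourier_wave//.
by rewrite sqrtr1 expr1n invr1 mul1r.
Qed.

Lemma wave_total w : sqinteg mu w -> (forall c, \int[mu]_x (w x * wave 1 c x) = 0) ->
  w = cst 0 %[ae mu].
Proof.
move=> hw w0; have fi := sqinteg_mul hw (sqinteg_gaussn 0).
have : (fun x => w x * gaussn 1 0 x) = cst 0 %[ae mu].
  apply: real_fourier_eq0 => // y; rewrite /real_fourier -[RHS](mulr0 (Num.sqrt ((2 * pi) ^+ n))^-1).
  congr (_ * _); rewrite -(w0 y); apply: eq_Rintegral => x _.
  by rewrite /wave /cas (rV_dotC y) mulrA.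
apply: filterS => x /= h _; have /eqP := h I; rewrite mulf_eq0 => /orP[/eqP//|].
by rewrite gt_eqF// gaussnE expR_gt0.
Qed.

Lemma extension_involutive u w z : sqinteg mu u ->
  extension_of u w -> extension_of w z -> z = u %[ae mu].
Proof.
move=> hu [hw _ Ew] [hz _ Ez].
have : (fun x => z x - u x) = cst 0 %[ae mu].
  apply: wave_total; first exact: sqintegB.
  move=> c; have wi := integ_wave c (@ltr01 R); have w2 := sqinteg_wave c.
  under eq_Rintegral do rewrite mulrBl.
  rewrite RintegralB//; try exact: sqinteg_mul.
  rewrite Ez// real_fourier_wave1 Ew//; [|exact: integ_gaussn|exact: sqinteg_gaussn].
  by rewrite real_fourier_gaussn subrr.
by apply: filterS => x /= h _; apply/eqP; rewrite -subr_eq0; apply/eqP; exact: h I.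
Qed.

Lemma extension_wave u w v : sqinteg mu u -> extension_of u w -> sqinteg mu v ->
  (forall c, \int[mu]_x (v x * wave 1 c x) = \int[mu]_x (u x * gaussn 1 c x)) ->
  v = w %[ae mu].
Proof.
move=> hu [hw _ Ew] hv vu.
have : (fun x => v x - w x) = cst 0 %[ae mu].
  apply: wave_total; first exact: sqintegB.
  move=> c; have wi := integ_wave c (@ltr01 R); have w2 := sqinteg_wave c.
  under eq_Rintegral do rewrite mulrBl.
  rewrite RintegralB//; try exact: sqinteg_mul.
  by rewrite vu Ew// real_fourier_wave1 subrr.
by apply: filterS => x /= h _; apply/eqP; rewrite -subr_eq0; apply/eqP; exact: h I.
Qed.

End extension.

(** * Gaussians are Schwartz functions *)

Section gaussian_schwartz.
Variables (R : realType) (n : nat) (c : 'rV[R]_n).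
Local Notation V := 'rV[R]_n.
Implicit Types x : V.

(* Formal polynomials: the iterated partial derivatives of a Gaussian stay of the form
   polynomial times Gaussian. *)
Inductive pexpr : Type :=
  | PConst of R
  | PVar of 'I_n
  | PAdd of pexpr & pexpr
  | PMul of pexpr & pexpr.

Fixpoint peval p : V -> R :=
  match p with
  | PConst a => fun=> a
  | PVar j => fun x => x ord0 j
  | PAdd p q => peval p + peval q
  | PMul p q => peval p * peval q
  end.

Fixpoint pderiv i p : pexpr :=
  match p with
  | PConst a => PConst 0
  | PVar j => PConst (i == j)%:R
  | PAdd p q => PAdd (pderiv i p) (pderiv i q)
  | PMul p q => PAdd (PMul p (pderiv i q)) (PMul q (pderiv i p))
  end.

Lemma differentiable_coord_rV j x : differentiable (fun x : V => x ord0 j : R) x.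
Proof. exact: differentiable_coord. Qed.

Lemma derive_coord j (v x : V) : 'D_v (fun x : V => x ord0 j : R) x = v ord0 j.
Proof.
apply/cvg_lim => //; apply: (cvg_near_cst (v ord0 j)); near=> h.
rewrite /= !mxE addrK /GRing.scale/= mulKf//.
near: h; exact: nbhs_dnbhs_neq.
Unshelve. all: by end_near. Qed.

Lemma differentiable_peval p x : differentiable (peval p) x.
Proof.
elim: p => [a|j|p IHp q IHq|p IHp q IHq] /=.
- exact: differentiable_cst.
- exact: differentiable_coord_rV.
- exact: differentiableD.
- exact: differentiableM.
Qed.

Lemma derive_peval i p x : 'D_(delta_mx ord0 i) (peval p) x = peval (pderiv i p) x.
Proof.
elim: p => [a|j|p IHp q IHq|p IHp q IHq] /=.
- by rewrite derive_cst.
- by rewrite derive_coord mxE eqxx/= eq_sym.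
- by rewrite deriveD ?IHp ?IHq//; apply: diff_derivable; exact: differentiable_peval.
- by rewrite deriveM ?IHp ?IHq//; apply: diff_derivable; exact: differentiable_peval.
Qed.

(** The exponent [-|x - c|^2 / 2] as a formal polynomial, so that the factor produced by the chain
    rule is again a formal polynomial. *)
Definition qexpr : pexpr :=
  \big[PAdd/PConst 0]_(i < n) PMul (PConst (- 2^-1))
    (PMul (PAdd (PVar i) (PConst (- c ord0 i))) (PAdd (PVar i) (PConst (- c ord0 i)))).

Lemma peval_sum (F : 'I_n -> pexpr) x :
  peval (\big[PAdd/PConst 0]_(i < n) F i) x = \sum_(i < n) peval (F i) x.
Proof. by elim/big_rec2: _ => [|i y1 y2 _ IH] //=; rewrite -IH. Qed.

Lemma gaussn1E x : gaussn 1 c x = expR (peval qexpr x).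
Proof.
rewrite gaussnE peval_sum mul1r mulr_suml -sumrN; congr expR; apply: eq_bigr => i _ /=.
rewrite !fctE /=; ring.
Qed.

Definition pgauss p x := peval p x * expR (peval qexpr x).

Lemma differentiable_pgauss p x : differentiable (pgauss p) x.
Proof.
apply: differentiableM; first exact: differentiable_peval.
apply: differentiable_comp; first exact: differentiable_peval.
exact/derivable1_diffP.
Qed.

Lemma derive_expR_comp (Q : V -> R) (v x : V) : differentiable Q x ->
  'D_v (expR \o Q) x = expR (Q x) * 'D_v Q x.
Proof.
move=> dQ; have dE : differentiable (@expR R) (Q x) by exact/derivable1_diffP.
rewrite !deriveE//; last exact: differentiable_comp.
rewrite diff_comp//= (@deriv1E _ _ (@expR R) (Q x) (@derivable_expR R (Q x))).
by rewrite derive1E derive_val /GRing.scale /= mulrC.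
Qed.

Lemma partial_pgauss i p : partial i (pgauss p) =
  pgauss (PAdd (pderiv i p) (PMul p (pderiv i qexpr))).
Proof.
apply/funext => x; rewrite /partial.
have dp := differentiable_peval p x; have dq := differentiable_peval qexpr x.
have dE : differentiable (expR \o peval qexpr) x.
  by apply: differentiable_comp => //; exact/derivable1_diffP.
rewrite [LHS](@deriveM _ _ (peval p) (expR \o peval qexpr)); [|exact: diff_derivable..].
rewrite derive_expR_comp// !derive_peval /pgauss /= /GRing.scale /= !fctE.
by ring.
Qed.

Lemma partials_pgauss s p : exists q, partials s (pgauss p) = pgauss q.
Proof.
elim: s => [|i s [q IH]]; first by exists p.
by eexists; rewrite /= IH partial_pgauss.
Qed.

(** Being at least 1, [N x] has powers that increase with the exponent, so bounds with different
    exponents can be added. *)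
Let N x := 1 + \sum_(i < n) x ord0 i ^+ 2.

Let N1 x : 1 <= N x.
Proof. by rewrite lerDl sumr_ge0// => i _; exact: sqr_ge0. Qed.

Definition poly_growth (f : V -> R) := exists C k, forall x, `|f x| <= C * N x ^+ k.

Let poly_growth_cst a : poly_growth (fun=> a).
Proof. by exists `|a|, 0%N => x; rewrite expr0 mulr1. Qed.

Let poly_growth_coord j : poly_growth (fun x => x ord0 j).
Proof.
exists 1, 1%N => x; rewrite mul1r expr1.
apply: (@le_trans _ _ (1 + x ord0 j ^+ 2)).
  rewrite -(real_normK (num_real (x ord0 j))).
  by have := sqr_ge0 (`|x ord0 j| - 1); have := normr_ge0 (x ord0 j); nra.
by rewrite lerD2l (bigD1 j)//= lerDl sumr_ge0// => i _; exact: sqr_ge0.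
Qed.

Let poly_growthM f g : poly_growth f -> poly_growth g -> poly_growth (fun x => f x * g x).
Proof.
move=> [C [k fC]] [D [l gD]]; exists (C * D), (k + l)%N => x.
by rewrite normrM exprD mulrACA ler_pM.
Qed.

Let poly_growthD f g : poly_growth f -> poly_growth g -> poly_growth (fun x => f x + g x).
Proof.
move=> [C [k fC]] [D [l gD]]; exists (`|C| + `|D|), (k + l)%N => x.
have N0 : 0 <= N x by apply: le_trans (N1 x).
apply: le_trans (ler_normD _ _) _; rewrite mulrDl lerD//.
  apply: le_trans (fC x) _; apply: (@le_trans _ _ (`|C| * N x ^+ k)).
    by rewrite ler_wpM2r ?exprn_ge0// ler_norm.
  by rewrite ler_wpM2l// ler_weXn2l// leq_addr.
apply: le_trans (gD x) _; apply: (@le_trans _ _ (`|D| * N x ^+ l)).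
  by rewrite ler_wpM2r ?exprn_ge0// ler_norm.
by rewrite ler_wpM2l// ler_weXn2l// leq_addl.
Qed.

Let poly_growth_peval p : poly_growth (peval p).
Proof.
elim: p => [a|j|p IHp q IHq|p IHp q IHq] /=.
- exact: poly_growth_cst.
- exact: poly_growth_coord.
- exact: poly_growthD.
- exact: poly_growthM.
Qed.

Let poly_growthX f k : poly_growth f -> poly_growth (fun x => f x ^+ k).
Proof.
move=> hf; elim: k => [|k IH]; first exact: poly_growth_cst.
by under [X in poly_growth X]eq_fun do rewrite exprS; exact: poly_growthM.
Qed.

Let poly_growth_prod (s : seq 'I_n) (F : 'I_n -> V -> R) : (forall i, poly_growth (F i)) ->
  poly_growth (fun x => \prod_(i <- s) F i x).
Proof.
move=> hF; elim: s => [|i s IH].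
  by under [X in poly_growth X]eq_fun do rewrite big_nil; exact: poly_growth_cst.
by under [X in poly_growth X]eq_fun do rewrite big_cons; exact: poly_growthM.
Qed.

Let poly_growth_gaussn f : poly_growth f -> exists M, forall x, `|f x * gaussn 1 c x| <= M.
Proof.
move=> [C [k fC]].
pose S x := \sum_(i < n) (x ord0 i - c ord0 i) ^+ 2.
have S0 x : 0 <= S x by apply: sumr_ge0 => i _; exact: sqr_ge0.
pose D := \sum_(i < n) c ord0 i ^+ 2.
have D0 : 0 <= D by apply: sumr_ge0 => i _; exact: sqr_ge0.
(* [N x <= 2 (1 + D) (1 + S x)] and [1 + S x <= 2 (k + 1) exp(S x / (2 (k + 1)))]. Each of [k + 1]
   factors [N x] takes an equal share of the exponent [S x / 2], and together they use up the
   Gaussian exactly. Taking [k + 1] factors keeps the divisor nonzero. *)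
pose K := 2 * (1 + D) * (2 * k.+1%:R).
have K0 : 0 <= K by rewrite !mulr_ge0// addr_ge0.
have NS x : N x <= K * expR (S x / 2 / k.+1%:R).
  have h1 : N x <= 2 * (1 + D) * (1 + S x).
    have : N x <= 1 + (2 * S x + 2 * D).
      rewrite lerD2l /S /D !mulr_sumr -big_split/=; apply: ler_sum => i _.
      (* [x^2 <= 2 (x - c)^2 + 2 c^2], the difference being [(x - 2 c)^2]. *)
      by have := sqr_ge0 (x ord0 i - 2 * c ord0 i); nra.
    by move/le_trans; apply; have := mulr_ge0 D0 (S0 x); nra.
  apply: le_trans h1 _; rewrite /K -[leRHS]mulrA ler_wpM2l ?mulr_ge0 ?addr_ge0//.
  apply: (@le_trans _ _ (2 * k.+1%:R * (1 + S x / 2 / k.+1%:R))).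
    rewrite mulrDr mulr1 (_ : 2 * k.+1%:R * _ = S x); last by field.
    rewrite lerD2r -natrM ler1n//.
  by rewrite ler_wpM2l ?mulr_ge0 ?ler0n// expR_ge1Dx.
exists (`|C| * K ^+ k.+1) => x.
rewrite normrM (ger0_norm (gaussn_ge0 _ _ _)).
apply: (@le_trans _ _ (`|C| * N x ^+ k.+1 * gaussn 1 c x)).
  rewrite ler_wpM2r ?gaussn_ge0//; apply: le_trans (fC x) _.
  apply: (@le_trans _ _ (`|C| * N x ^+ k)).
    by rewrite ler_wpM2r ?ler_norm// exprn_ge0// (le_trans _ (N1 x)).
  by rewrite ler_wpM2l// ler_weXn2l.
rewrite -mulrA ler_wpM2l//.
apply: (@le_trans _ _ ((K * expR (S x / 2 / k.+1%:R)) ^+ k.+1 * gaussn 1 c x)).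
  have ? : 0 <= K * expR (S x / 2 / k.+1%:R) by rewrite mulr_ge0// expR_ge0.
  by rewrite ler_wpM2r ?gaussn_ge0// lerXn2r ?nnegrE// (le_trans _ (N1 x)).
rewrite exprMn -expRM_natl gaussnE mul1r -/(S x) -[leLHS]mulrA -expRD.
rewrite (_ : _ + _ = 0) ?expR0 ?mulr1//; by field.
Qed.

Lemma schwartz_gaussn : schwartz (gaussn 1 c).
Proof.
have E : gaussn 1 c = pgauss (PConst 1).
  by apply/funext => x; rewrite gaussn1E /pgauss /= mul1r.
split=> [s|a s].
  have [q] := partials_pgauss s (PConst 1); rewrite -E => ->; split=> [x|i x].
    by apply: differentiable_continuous; exact: differentiable_pgauss.
  by apply: diff_derivable; exact: differentiable_pgauss.
have [q] := partials_pgauss s (PConst 1); rewrite -E => ->.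
have [M HM] : exists M, forall x, `|(monomial a x * peval q x) * gaussn 1 c x| <= M.
  apply: poly_growth_gaussn; apply: poly_growthM => //.
  by apply: poly_growth_prod => i; apply: poly_growthX; exact: poly_growth_coord.
by exists M => x; rewrite /pgauss mulrA -gaussn1E.
Qed.

End gaussian_schwartz.

(** * The operator on L2 *)

Section L2_classes.
Variables (R : realType) (n : nat).
Local Notation mu := (lebesgue_rV R n).
Implicit Types u v : L2 R n.

Lemma sqinteg_Lspace_repr u : sqinteg mu (Lspace_repr u).
Proof.
split; first exact: measurable_funPT.
exact: Lfun2_integrable_sqr (LfunP (Lspace_repr u)).
Qed.

Lemma sqinteg_Lfun2 (f : 'rV[R]_n -> R) : sqinteg mu f -> f \in Lfun mu 2%:R%:E.
Proof.
move=> [mf fi]; rewrite inE; apply/andP; split; rewrite inE//=.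
rewrite /finite_norm unlock /Lnorm poweR_lty//.
have /integrableP[_] := fi; congr (_ < _)%E.
by apply: eq_integral => x _ /=; rewrite powR_mulrn// normrX.
Qed.

Definition L2_class (f : 'rV[R]_n -> R) (hf : sqinteg mu f) : L2 R n :=
  Lspace_class (Lfun_Sub (lee1n 2) (sqinteg_Lfun2 hf)).

Lemma L2_classK f hf : Lspace_repr (@L2_class f hf) = f %[ae mu].
Proof. exact: Lspace_classK. Qed.

Lemma schwartz_L2K f (sf : schwartz f) : Lspace_repr (schwartz_L2 sf) = f %[ae mu].
Proof. exact: Lspace_classK. Qed.

Lemma Lspace_repr_linear a u v :
  Lspace_repr (a *: u + v) = (fun x => a * Lspace_repr u x + Lspace_repr v x) %[ae mu].
Proof.
have -> : a *: u + v = Lspace_class (a *: Lspace_repr u + Lspace_repr v).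
  by rewrite linearP /= !Lspace_reprK.
exact: Lspace_classK.
Qed.

Lemma ae_eq_Rintegral (f g : 'rV[R]_n -> R) : measurable_fun setT f -> measurable_fun setT g ->
  f = g %[ae mu] -> \int[mu]_x f x = \int[mu]_x g x.
Proof.
move=> mf mg fg; rewrite /Rintegral; congr fine; apply: ae_eq_integral => //.
- exact/measurable_EFinP.
- exact/measurable_EFinP.
- by apply: filterS fg => x /= h _; rewrite h.
Qed.

Lemma ae_eq_Rintegral_mul (f g h : 'rV[R]_n -> R) : sqinteg mu f -> sqinteg mu g -> sqinteg mu h ->
  f = g %[ae mu] -> \int[mu]_x (f x * h x) = \int[mu]_x (g x * h x).
Proof.
move=> [mf _] [mg _] [mh _] fg; apply: ae_eq_Rintegral; try exact: measurable_funM.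
by apply: filterS fg => x /= k _; rewrite k.
Qed.

(** Together with [ae_extension_of], this makes the relation one between classes. The transforms of
    the truncations agree at every point, since integrals do not see null sets. *)
Lemma extension_of_ae (f g w : 'rV[R]_n -> R) : sqinteg mu f -> sqinteg mu g -> f = g %[ae mu] ->
  extension_of f w -> extension_of g w.
Proof.
move=> hf hg fg [hw c E].
have truncE k : real_fourier (trunc k f) = real_fourier (trunc k g).
  apply/funext => x; rewrite /real_fourier; congr (_ * _).
  apply: ae_eq_Rintegral; try (apply: measurable_funM; last exact: measurable_cas_dot).
  - by case: (sqinteg_trunc k hf).
  - by case: (sqinteg_trunc k hg).
  - by apply: filterS fg => y /= fgy _; rewrite /trunc fgy.
split; first exact: hw.
  by rewrite -(funext truncE).
move=> h hi h2; rewrite E//; apply: ae_eq_Rintegral_mul => //.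
by have [] := real_fourier_contraction hi h2.
Qed.

Lemma ae_extension_of (f w w' : 'rV[R]_n -> R) : sqinteg mu f -> sqinteg mu w' -> w = w' %[ae mu] ->
  extension_of f w -> extension_of f w'.
Proof.
move=> hf hw' ww' [hw c E]; split=> // [e e0|h hi h2]; last first.
  by rewrite -E//; apply: ae_eq_Rintegral_mul => //; exact: ae_eq_sym.
have [N HN] := c e e0; exists N => k /HN; congr (_ <= _).
have mH := measurable_real_fourier (integ_trunc k hf).
apply: ae_eq_Rintegral.
- by apply: measurable_funX; apply: measurable_funB => //; case: hw.
- by apply: measurable_funX; apply: measurable_funB => //; case: hw'.
- by apply: filterS ww' => x /= h _; rewrite h.
Qed.

Lemma extension_of_exists u : exists v, extension_of (Lspace_repr u) (Lspace_repr v).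
Proof.
have [w hw] := extension_exists (sqinteg_Lspace_repr u).
have [w2 _ _] := hw; exists (L2_class w2).
apply: ae_extension_of hw; [exact: sqinteg_Lspace_repr..|].
exact: ae_eq_sym (L2_classK w2).
Qed.

(** The choice is unambiguous: by [sqinteg_sep] the pairing clause determines the class. *)
Definition real_fourier_L2 u : L2 R n := sval (cid (extension_of_exists u)).

Local Notation T := real_fourier_L2.

Lemma real_fourier_L2P u : extension_of (Lspace_repr u) (Lspace_repr (T u)).
Proof. exact: (svalP (cid (extension_of_exists u))). Qed.

Lemma real_fourier_L2_linear : linear T.
Proof.
move=> a u v; apply/Lspace_eqP.
have hu := sqinteg_Lspace_repr u; have hv := sqinteg_Lspace_repr v.
have h : extension_of (fun x => a * Lspace_repr u x + Lspace_repr v x)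
    (Lspace_repr (T (a *: u + v))).
  apply: extension_of_ae (real_fourier_L2P _); first exact: sqinteg_Lspace_repr.
    by apply: sqintegD => //; exact: sqintegZ.
  exact: Lspace_repr_linear.
apply: ae_eq_trans (extension_linear hu hv (real_fourier_L2P u) (real_fourier_L2P v) h) _.
exact: ae_eq_sym (Lspace_repr_linear _ _ _).
Qed.

Lemma real_fourier_L2_involutive : involutive T.
Proof.
move=> u; apply/Lspace_eqP.
exact: extension_involutive (sqinteg_Lspace_repr u) (real_fourier_L2P _) (real_fourier_L2P _).
Qed.

Lemma real_fourier_L2_self_adjoint : self_adjoint T.
Proof.
move=> u v; exact: extension_sym (sqinteg_Lspace_repr u) (sqinteg_Lspace_repr v)
  (real_fourier_L2P _) (real_fourier_L2P _).
Qed.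

Lemma real_fourier_L2_unitary : unitary T.
Proof.
split; first exact: real_fourier_L2_linear.
  by exists T; exact: real_fourier_L2_involutive.
move=> u v.
by rewrite real_fourier_L2_self_adjoint real_fourier_L2_involutive.
Qed.

Lemma schwartz_integ (f : 'rV[R]_n -> R) : schwartz f -> integ mu f.
Proof.
move=> sf.
have mf : measurable_fun setT f.
  by apply: continuous_measurable_rV; have [/(_ [::])[]] := sf.
have [M fM] := schwartz_prod_bound sf.
apply: integ_le mf fM _; apply: integZl.
have mg : measurable_fun setT (fun x : 'rV[R]_n => \prod_(i < n) (oneDsqr (x ord0 i))^-1).
  apply: measurable_prod => i _.
  apply: (@measurableT_comp _ _ _ _ _ _ (fun t : R => (oneDsqr t)^-1)).
    by apply: continuous_measurable_fun; exact: continuous_oneDsqrV.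
  exact: measurable_coord.
apply/integrableP; split; first exact/measurable_EFinP.
under eq_integral.
  move=> x _ /=; rewrite ger0_norm; last first.
    by rewrite prodr_ge0// => i _; rewrite invr_ge0 ltW// oneDsqr_gt0.
  over.
by rewrite integral_prod_oneDsqrV ltry.
Qed.

Lemma schwartz_sqinteg (f : 'rV[R]_n -> R) : schwartz f -> sqinteg mu f.
Proof.
move=> sf; split; first exact: integ_measurable (schwartz_integ sf).
exact: Lfun2_integrable_sqr (schwartz_Lfun2 sf).
Qed.

Lemma real_fourier_L2_extends : extends_real_fourier T.
Proof.
move=> f sf; apply: (extension_L1 (schwartz_integ sf) (schwartz_sqinteg sf)).
apply: extension_of_ae (real_fourier_L2P _); first exact: sqinteg_Lspace_repr.
  exact: schwartz_sqinteg.
exact: schwartz_L2K.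
Qed.

Lemma real_fourier_L2_unique (S : L2 R n -> L2 R n) :
  unitary S -> extends_real_fourier S -> S = T.
Proof.
move=> [_ _ Sdot] Sext; apply/funext => u; apply/Lspace_eqP.
have hu := sqinteg_Lspace_repr u; have hSu := sqinteg_Lspace_repr (S u).
apply: (extension_wave hu (real_fourier_L2P u) hSu) => c.
have hg := sqinteg_gaussn c; have hw := sqinteg_wave c.
have := Sdot u (schwartz_L2 (schwartz_gaussn c)); rewrite /Lspace2_dot.
have := Sext _ (schwartz_gaussn c); rewrite real_fourier_gaussn => E1.
have hc (a b : 'rV[R]_n -> R) : \int[mu]_x (a x * b x) = \int[mu]_x (b x * a x).
  by apply: eq_Rintegral => x _; rewrite mulrC.
rewrite hc (ae_eq_Rintegral_mul (sqinteg_Lspace_repr _) hw hSu E1) hc => ->.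
by rewrite hc (ae_eq_Rintegral_mul (sqinteg_Lspace_repr _) hg hu (schwartz_L2K _)) hc.
Qed.

End L2_classes.

Theorem theorem2 (R : realType) (n : nat) (n_ge1 : (1 <= n)%N) :
  exists T : L2 R n -> L2 R n,
    [/\ unitary T,
        extends_real_fourier T,
        (forall S : L2 R n -> L2 R n,
          unitary S -> extends_real_fourier S -> S = T),
        involutive T &
        self_adjoint T].
Proof.
exists (@real_fourier_L2 R n); split.
- exact: real_fourier_L2_unitary.
- exact: real_fourier_L2_extends.
- exact: real_fourier_L2_unique.
- exact: real_fourier_L2_involutive.
- exact: real_fourier_L2_self_adjoint.
Qed.
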